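(* Fix $p\in(0,1/2]$ and let $d=d(n)$ be such that $d/\log n\to\infty$ as $n\to\infty$. If $(\log n)^c/d=o(1)$ for some $c>1$, then as $n\to\infty$, $$\left|\frac{n_{G(n,d,p)}(H)}{\mathbb{E}\bigl(n_{G(n,p)}(H)\bigr)}-1\right|\longrightarrow 0\quad\text{almost surely,}$$ for every fixed finite graph $H$.
   Context: Random geometric graph $G(n,d,p)$: let $\boldsymbol X_1,\dots,\boldsymbol X_n$ be independent and uniformly distributed on the unit sphere $\{\boldsymbol x\in\mathbb{R}^d:\|\boldsymbol x\|_2=1\}$. The vertex set is $[n]=\{1,\dots,n\}$, and $i\neq j$ are adjacent iff $\langle \boldsymbol X_i,\boldsymbol X_j\rangle\ge t_{p,d}$, where the constant $t_{p,d}$ is chosen so that $\mathbb{P}(\langle \boldsymbol X_i,\boldsymbol X_j\rangle\ge t_{p,d})=p$. The graphs for different $n$ are defined on a common probability space. $G(n,p)$ is the Erdős–Rényi random graph on $[n]$ with edge probability $p$. For graphs $G,H$, $n_G(H)$ is the number of induced isomorphic copies of $H$ in $G$ (number of vertex subsets of $G$ inducing a subgraph isomorphic to $H$). *)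

(* Defs.v *)
From HB Require Import structures.
From mathcomp Require Export all_boot all_order all_algebra.
From mathcomp Require Export all_classical all_reals all_analysis.
Export Order.TTheory GRing.Theory Num.Theory.
Export numFieldNormedType.Exports.

Set Implicit Arguments.
Unset Strict Implicit.
Unset Printing Implicit Defensive.

Local Open Scope classical_set_scope.
Local Open Scope ring_scope.

Section Euclidean.
Context {R : realType} {d : nat}.

(* R^d is [d.-tuple R]; its library sigma-algebra, generated by the coordinate
   maps, is the Borel one. *)
Implicit Types (x y : d.-tuple R) (Q : 'M[R]_d).

Definition dot x y : R := \sum_(i < d) tnth x i * tnth y i.

Definition unit_sphere : set (d.-tuple R) := [set x | Num.sqrt (dot x x) = 1].

Definition mx_act Q x : d.-tuple R :=
  [tuple \sum_(j < d) Q i j * tnth x j | i < d].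

(* The uniform law is the rotation-invariant probability carried by the
   sphere; invariance is under the whole orthogonal group O(d). *)
Definition uniform_on_sphere (mu : set (d.-tuple R) -> \bar R) : Prop :=
  mu unit_sphere = 1%E /\
  forall Q, Q *m Q^T = 1%:M ->
  forall A : set (d.-tuple R), measurable A -> mu (mx_act Q @^-1` A) = mu A.

End Euclidean.

Definition mutually_independent {R : realType} {disp disp' : measure_display}
    {Omega : measurableType disp} {T : measurableType disp'}
    (P : probability Omega R) (I : finType) (X : I -> Omega -> T) : Prop :=
  forall (J : {set I}) (A : I -> set T), (forall i, measurable (A i)) ->
  P (\bigcap_(i in [set` J]) (X i @^-1` A i)) =
  (\prod_(i in J) P (X i @^-1` A i))%E.

Local Close Scope classical_set_scope.

Definition simple_graph (V : finType) (e : rel V) : Prop :=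
  symmetric e /\ irreflexive e.

(* [e] induces on the vertex set [S] a graph isomorphic to [h]. *)
Definition induces_copy (V T : finType) (h : rel V) (e : rel T)
    (S : {set T}) : bool :=
  [exists f : {ffun V -> T},
    [&& injectiveb f, f @: [set: V]%SET == S &
        [forall u, forall v, h u v == e (f u) (f v)]]].

Definition num_induced (V T : finType) (h : rel V) (e : rel T) : nat :=
  #|[set S : {set T} | induces_copy h e S]%SET|.

Section ErdosRenyi.
Context {R : realType} (n : nat).

Definition vertex_pairs : {set {set 'I_n}} :=
  [set e : {set 'I_n} | #|e| == 2%N]%SET.

Definition edge_rel (E : {set {set 'I_n}}) : rel 'I_n :=
  fun i j => (i != j) && ([set i; j]%SET \in E).

(* P(edge set of G(n,p) = E) for [E] a subset of [vertex_pairs]. *)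
Definition er_prob (p : R) (E : {set {set 'I_n}}) : R :=
  \prod_(e in vertex_pairs) (if e \in E then p else 1 - p).

Definition er_expectation (p : R) (F : rel 'I_n -> R) : R :=
  \sum_(E in powerset vertex_pairs) er_prob p E * F (edge_rel E).

End ErdosRenyi.

Definition geometric_graph {R : realType} {n d : nat} (t : R)
    (x : 'I_n -> d.-tuple R) : rel 'I_n :=
  fun i j => (i != j) && (t <= dot (x i) (x j)).

(* Main.v *)
Require Import Defs.
From mathcomp Require Import ring lra measurable_realfun.

(** Let f(x,y) = 1[t <= <x,y>] - p be the centered adjacency kernel, so that
    F i j = f (X i) (X j), with F i i = 0, is the centered adjacency matrix of
    the geometric graph. The proof shows that the graph is almost surely quasirandom and then
    counts. The dimension enters through d(n) -> infinity, which follows from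
    d / log n -> infinity.

    Counting. The number of embeddings of H is a sum, over maps phi from V to
    [n], of products over the pairs of V of factors q + s * F, where q is p or
    1 - p and s is a sign. Replacing the factors by q one at a time costs sums
    of the shape sum F i j * a i * b j with |a|, |b| <= 1 ([sum_prod_edges]),
    and by Cauchy-Schwarz such a sum is small as soon as
    W = sum_(j,j') |sum_i F i j * F i j'| is o(n^3) ([cut_le_codegree]). As
    every copy of H is the image of |Aut H| embeddings, both for the geometric
    graph and in the Erdos-Renyi expectation, the ratio of the theorem tends to
    1 when W = o(n^3) ([ratio_bound]).

    Codegrees. Let K(x,x') be the mean of f(x,Y) f(x',Y) over a point Y of the
    sphere. It depends only on s = <x,x'>, because O(d) acts transitively on
    the pairs of unit vectors with given inner product ([rotate_pair]).
    Evaluating the positive semidefinite kernel K on m+1 unit vectors with all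
    pairwise inner products s gives 1 + m K >= 0 as soon as 1 + m s >= 0
    ([codegree_lower]). As the mean of s^2 is 1/d, K is bounded below by about
    -1/m for most pairs. The codegrees of F sum to sum_i (sum_j F i j)^2, which
    is small, so this lower bound also bounds the sum of their absolute values
    ([codegree_sum_le]).

    Concentration. Degrees, codegrees minus their conditional means, and the
    sums of <X j, X i>^2 - 1/d are all sums of terms that have mean zero
    conditionally on one or two of the points. By independence the fourth
    moment of such a sum is O(n^2) ([centered_sum_fourth_moment]), so the
    normalized total [deviation] has mean O(1/n^2). This is summable, which
    gives almost sure convergence to 0 whatever the joint law of the samples
    for different n. *)

Set Implicit Arguments.
Unset Strict Implicit.
Unset Printing Implicit Defensive.

Local Open Scope classical_set_scope.
Local Open Scope ring_scope.

(** * Counting maps through products over pairs *)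

Lemma le_of_eq (R : numDomainType) (x y : R) : x = y -> x <= y.
Proof. by move=> ->. Qed.

Lemma fourth_ge0 (R : realFieldType) (u : R) : 0 <= u ^+ 4.
Proof. by rewrite -[4%N]/(2 * 2)%N exprM sqr_ge0. Qed.

Lemma sqr_sum_le (R : realFieldType) (I : finType) (z : I -> R) :
  (\sum_i z i) ^+ 2 <= #|I|%:R * \sum_i z i ^+ 2.
Proof.
have pw (i j : I) : z i * z j <= 2^-1 * (z i ^+ 2 + z j ^+ 2).
  rewrite -subr_ge0; have -> : 2^-1 * (z i ^+ 2 + z j ^+ 2) - z i * z j
    = 2^-1 * (z i - z j) ^+ 2 by field.
  by rewrite mulr_ge0 ?sqr_ge0.
rewrite expr2 big_distrlr /=.
apply: (@le_trans _ _ (\sum_i \sum_j 2^-1 * (z i ^+ 2 + z j ^+ 2))).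
  by apply: ler_sum => i _; apply: ler_sum => j _.
have -> : \sum_i \sum_j 2^-1 * (z i ^+ 2 + z j ^+ 2)
  = 2^-1 * (#|I|%:R * \sum_i z i ^+ 2 + #|I|%:R * \sum_i z i ^+ 2).
  under eq_bigr do rewrite -mulr_sumr big_split /= sumr_const.
  by rewrite -mulr_sumr big_split /= sumr_const sumrMnl !mulr_natl.
by apply: le_of_eq; field.
Qed.

Section Update.
Variables (V I : finType).

Definition update (phi : {ffun V -> I}) (u : V) (i : I) : {ffun V -> I} :=
  [ffun w => if w == u then i else phi w].

Lemma updateK phi u i : update (update phi u i) u (phi u) = phi.
Proof. by apply/ffunP => w; rewrite !ffunE; case: eqP => // ->. Qed.

(** Averaging over the value at one point of V:
    (phi, i) |-> (update phi u i, phi u) is an involution. This isolates the two endpoints of a pair without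
    splitting the domain of phi. *)
Lemma sum_update (R : pzRingType) (G : {ffun V -> I} -> R) (u : V) :
  #|I|%:R * \sum_phi G phi = \sum_phi \sum_i G (update phi u i).
Proof.
rewrite [RHS]pair_bigA /=.
pose h (x : {ffun V -> I} * I) := (update x.1 u x.2, x.1 u).
have hK : involutive h.
  by case=> phi i; rewrite /h /= updateK ffunE eqxx.
rewrite (reindex_inj (inv_inj hK)) /=.
under [RHS]eq_bigr do rewrite /h /= updateK.
rewrite -(pair_bigA _ (fun phi (i : I) => G phi)) /=.
by rewrite mulr_sumr; apply: eq_bigr => phi _; rewrite sumr_const mulr_natl.
Qed.

End Update.

Section Counting.
Variables (R : realFieldType) (V I : finType).

(** Cauchy-Schwarz over i removes a; expanding the square leaves b j * b j'
    times the codegree of j and j'. *)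
Lemma cut_le_codegree (F : I -> I -> R) (a b : I -> R) :
  (forall i, `|a i| <= 1) -> (forall j, `|b j| <= 1) ->
  (\sum_i \sum_j F i j * a i * b j) ^+ 2 <=
  #|I|%:R * \sum_j \sum_j' `|\sum_i F i j * F i j'|.
Proof.
move=> a1 b1; pose u i := \sum_j F i j * b j.
have -> : \sum_i \sum_j F i j * a i * b j = \sum_i a i * u i.
  apply: eq_bigr => i _; rewrite /u mulr_sumr; apply: eq_bigr => j _; ring.
apply: (le_trans (sqr_sum_le _)); apply: ler_wpM2l; first exact: ler0n.
apply: (@le_trans _ _ (\sum_i u i ^+ 2)).
  apply: ler_sum => i _; rewrite exprMn -[leRHS]mul1r.
  by rewrite ler_wpM2r ?sqr_ge0 // -real_normK ?num_real // exprn_ile1.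
have -> : \sum_i u i ^+ 2 = \sum_j \sum_j' b j * b j' * \sum_i F i j * F i j'.
  under eq_bigr do rewrite expr2 big_distrlr /=.
  rewrite exchange_big /=; apply: eq_bigr => j _.
  rewrite exchange_big /=; apply: eq_bigr => j' _.
  by rewrite mulr_sumr; apply: eq_bigr => i _; ring.
apply: ler_sum => j _; apply: ler_sum => j' _.
apply: (le_trans (ler_norm _)); rewrite normrM -[leRHS]mul1r.
by rewrite ler_wpM2r // normrM mulr_ile1.
Qed.

(** For pairs with distinct entries: e and f are equal as unordered pairs. *)
Definition meets_both (e f : V * V) : bool :=
  ((f.1 == e.1) || (f.2 == e.1)) && ((f.1 == e.2) || (f.2 == e.2)).

(** Induction on the list of pairs. Splitting off the factor of e = (u,v) leaves
    an error sum with the integrand F (phi u) (phi v) times the other factors;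
    none of these meets both u and v, so after averaging over the values at u
    and v they form a product a i * b j, and the cut hypothesis applies. *)
Lemma sum_prod_edges (F : I -> I -> R) (delta : R) (q s : V * V -> R)
    (es : seq (V * V)) :
  (forall a b : I -> R, (forall i, `|a i| <= 1) -> (forall j, `|b j| <= 1) ->
     `|\sum_i \sum_j F i j * a i * b j| <= delta * #|I|%:R ^+ 2) ->
  0 <= delta ->
  (forall e, `|q e| <= 1) -> (forall e, `|s e| <= 1) ->
  (forall e i j, `|q e + s e * F i j| <= 1) ->
  pairwise (fun e f => (e.1 != e.2) && ~~ meets_both e f) es ->
  all (fun e => e.1 != e.2) es ->
  `|\sum_(phi : {ffun V -> I})
      \prod_(e <- es) (q e + s e * F (phi e.1) (phi e.2))
    - #|I|%:R ^+ #|V| * \prod_(e <- es) q e|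
  <= (size es)%:R * (delta * #|I|%:R ^+ #|V|).
Proof.
move=> cutF d0 q1 s1 qs1.
have [I0|I0] := posnP #|I|.
  move=> _ _.
  case: es => [|e es].
    under [X in X - _]eq_bigr do rewrite big_nil.
    by rewrite big_nil sumr_const card_ffun natrX mulr1 subrr normr0 mul0r.
  have V0 : #|V| != 0 by rewrite -lt0n; apply/card_gt0P; exists e.1.
  rewrite I0 expr0n (negbTE V0) mul0r subr0 !mulr0 big1 ?normr0 // => phi.
  by have := card0_eq I0 (phi e.1); rewrite inE.
set N : R := #|I|%:R.
have N0 : 0 < N by rewrite ltr0n.
elim: es => [|e es IH].
  move=> _ _; under [X in X - _]eq_bigr do rewrite big_nil.
  by rewrite big_nil sumr_const card_ffun natrX mulr1 subrr normr0 mul0r.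
rewrite pairwise_cons => /andP[/allP esP pes] /= /andP[ne aes].
have {}IH := IH pes aes.
under eq_bigr do rewrite big_cons mulrDl.
rewrite big_split /= -mulr_sumr big_cons.
set S1 := \sum_phi _ in IH *; set S2 := (X in _ + X - _).
set Q := \prod_(j <- es) _ in IH *.
have S2le : `|S2| <= delta * N ^+ #|V|.
  pose g (f : V * V) (phi : {ffun V -> I}) :=
    q f + s f * F (phi f.1) (phi f.2).
  pose hasv (f : V * V) := (f.1 == e.2) || (f.2 == e.2).
  pose A (phi : {ffun V -> I}) := s e * \prod_(f <- es | hasv f) g f phi.
  pose B (phi : {ffun V -> I}) := \prod_(f <- es | ~~ hasv f) g f phi.
  have S2E : S2 = \sum_(phi : {ffun V -> I}) F (phi e.1) (phi e.2) * B phi * A phi.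
    apply: eq_bigr => phi _; rewrite (bigID hasv) /= /A /B /g; ring.
  have g1 (P : pred (V * V)) (phi : {ffun V -> I}) :
      `|\prod_(f <- es | P f) g f phi| <= 1.
    rewrite normr_prod; apply: prodr_ile1 => f _.
    by rewrite normr_ge0 qs1.
  have Bv phi j : B (update phi e.2 j) = B phi.
    apply: eq_bigr => f; rewrite negb_or => /andP[/negbTE f1 /negbTE f2].
    by rewrite /g !ffunE f1 f2.
  have Au phi i : A (update phi e.1 i) = A phi.
    rewrite /A; congr (_ * _); rewrite big_seq_cond [RHS]big_seq_cond.
    apply: eq_bigr => f /andP[fes hf].
    have := esP _ fes; rewrite ne /= /meets_both -/(hasv f) hf andbT.
    by rewrite negb_or /g !ffunE => /andP[/negbTE -> /negbTE ->].
  have -> : S2 = N ^- 2 * \sum_(phi : {ffun V -> I}) \sum_i \sum_j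
      F i j * B (update phi e.1 i) * A (update phi e.2 j).
    have E : N * (N * S2) = \sum_(phi : {ffun V -> I}) \sum_i \sum_j
      F i j * B (update phi e.1 i) * A (update phi e.2 j).
      rewrite S2E (sum_update _ e.2) (sum_update _ e.1); apply: eq_bigr => phi _.
      apply: eq_bigr => i _; apply: eq_bigr => j _.
      rewrite Bv; congr (F _ _ * _ * _).
      - by rewrite !ffunE (negbTE ne) eqxx.
      - by rewrite !ffunE eqxx.
      - have -> : update (update phi e.1 i) e.2 j = update (update phi e.2 j) e.1 i.
          apply/ffunP => w; rewrite !ffunE; case: eqP => // ->.
          by rewrite eq_sym (negbTE ne).
        by rewrite Au.
    by rewrite -E; field; rewrite gt_eqF.
  have N20 : 0 <= N ^- 2 by rewrite invr_ge0 exprn_ge0 // ltW.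
  rewrite normrM (ger0_norm N20).
  rewrite [leLHS]mulrC ler_pdivrMr ?exprn_gt0 //.
  apply: (le_trans (ler_norm_sum _ _ _)).
  apply: (@le_trans _ _ (\sum_(phi : {ffun V -> I}) delta * N ^+ 2)).
    apply: ler_sum => phi _; apply: cutF => i; first exact: g1.
    by rewrite normrM mulr_ile1.
  rewrite sumr_const card_ffun -[_ *+ _]mulr_natl natrX.
  by apply: le_of_eq; ring.
have -> : q e * S1 + S2 - N ^+ #|V| * (q e * Q) =
  q e * (S1 - N ^+ #|V| * Q) + S2 by ring.
apply: (le_trans (ler_normD _ _)).
rewrite -[(size es).+1]addn1 natrD mulrDl mul1r lerD //.
rewrite normrM -[leRHS]mul1r; exact: ler_pM.
Qed.

End Counting.

(** * Embeddings and the Erdos-Renyi expectation *)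

Definition embeds (V T : finType) (h : rel V) (e : rel T)
    (f : {ffun V -> T}) : bool :=
  [forall u, forall v, h u v == e (f u) (f v)].

Definition num_embeddings (V T : finType) (h : rel V) (e : rel T) : nat :=
  #|[set f : {ffun V -> T} | injectiveb f && embeds h e f]%SET|.

Lemma embedsP (V T : finType) (h : rel V) (e : rel T) (f : {ffun V -> T}) :
  reflect (forall u v, h u v = e (f u) (f v)) (embeds h e f).
Proof.
apply: (iffP forallP) => [E u v|E u]; first by have /forallP /(_ v) /eqP := E u.
by apply/forallP => v; rewrite E.
Qed.

Lemma num_automorphisms_gt0 (V : finType) (h : rel V) :
  (0 < num_embeddings h h)%N.
Proof.
apply/card_gt0P; exists [ffun v => v]; rewrite inE; apply/andP; split.
  by apply/injectiveP => u v; rewrite !ffunE.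
by apply/embedsP => u v; rewrite !ffunE.
Qed.

(** An embedding is determined by its image together with an automorphism of h:
    composing a fixed embedding with the automorphisms gives all the
    embeddings with the same image. *)
Lemma num_embeddingsE (V T : finType) (h : rel V) (e : rel T) :
  num_embeddings h e = (num_induced h e * num_embeddings h h)%N.
Proof.
rewrite /num_embeddings -sum1_card.
rewrite (partition_big (fun f : {ffun V -> T} => f @: [set: V]%SET)
  (fun S => S \in [set S | induces_copy h e S]%SET)) /=; last first.
  move=> f; rewrite !inE => /andP[injf ef]; apply/existsP; exists f.
  by rewrite injf eqxx.
rewrite /num_induced -sum_nat_const; apply: eq_bigr => S.
rewrite inE => /existsP[f0 /and3P[/injectiveP inj0 /eqP im0 /embedsP e0]].
rewrite sum1dep_card.
pose c (g : {ffun V -> V}) : {ffun V -> T} := [ffun v => f0 (g v)].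
have injc : injective c.
  move=> g g' /ffunP cE; apply/ffunP => v; apply: inj0.
  by have := cE v; rewrite !ffunE.
rewrite -(card_imset _ injc); apply: eq_card => f; rewrite !inE.
apply/idP/imsetP.
  move=> /andP[/andP[/injectiveP injf /embedsP ef] /eqP imf].
  have pre v : {w | f v = f0 w}.
    have : f v \in f0 @: [set: V]%SET by rewrite im0 -imf imset_f // inE.
    by move=> /imsetP /cid2 [w _ fw]; exists w.
  exists [ffun v => sval (pre v)]; last first.
    by apply/ffunP => v; rewrite !ffunE; case: (pre v).
  rewrite inE; apply/andP; split.
    apply/injectiveP => u v; rewrite !ffunE.
    case: (pre u) (pre v) => /= w wu [w' w'v] ww; apply: injf.
    by rewrite wu w'v ww.
  apply/embedsP => u v; rewrite !ffunE ef [RHS]e0.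
  by case: (pre u) (pre v) => /= w <- [w' <-].
move=> [g]; rewrite inE => /andP[/injectiveP injg /embedsP eg] ->.
have injcg : injective (c g).
  by move=> u v; rewrite !ffunE => /inj0 /injg.
apply/andP; split; first (apply/andP; split).
- exact/injectiveP.
- by apply/embedsP => u v; rewrite !ffunE -e0.
rewrite eqEcard; apply/andP; split.
  apply/fintype.subsetP => x /imsetP[v _ ->]; rewrite ffunE -im0.
  by apply: imset_f; rewrite inE.
by rewrite -im0 !card_imset.
Qed.

Section Pattern.
Variables (R : realFieldType) (V : finType) (h : rel V).

Definition vpairs : seq (V * V) :=
  [seq e <- enum {: V * V} | (enum_rank e.1 < enum_rank e.2)%N].

Definition pair_target (p : R) (e : V * V) : R := if h e.1 e.2 then p else 1 - p.
Definition pair_sign (e : V * V) : R := if h e.1 e.2 then 1 else - 1.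

Lemma mem_vpairs e : (e \in vpairs) = (enum_rank e.1 < enum_rank e.2)%N.
Proof. by rewrite mem_filter mem_enum andbT. Qed.

Lemma vpairs_uniq : uniq vpairs.
Proof. by rewrite filter_uniq ?enum_uniq. Qed.

Lemma vpairs_neq e : e \in vpairs -> e.1 != e.2.
Proof. by rewrite mem_vpairs; case: eqP => // ->; rewrite ltnn. Qed.

Lemma meets_both_vpairs e f :
  e \in vpairs -> f \in vpairs -> meets_both e f -> e = f.
Proof.
rewrite !mem_vpairs; case: e f => [e1 e2] [f1 f2] /= lte ltf.
rewrite /meets_both /= => /andP[] /orP[] /eqP E1 /orP[] /eqP E2; subst=> //.
- by rewrite ltnn in lte.
- by have := ltn_trans lte ltf; rewrite ltnn.
- by rewrite ltnn in lte.
Qed.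

Lemma vpairs_pairwise :
  pairwise (fun e f => (e.1 != e.2) && ~~ meets_both e f) vpairs.
Proof.
have : pairwise (fun e f : V * V => e != f) vpairs.
  by rewrite -uniq_pairwise vpairs_uniq.
have all_in : all (mem vpairs) vpairs by apply/allP.
apply: (sub_in_pairwise _ all_in) => e f ein fin /negP ef; rewrite vpairs_neq //=.
by apply/negP => /(meets_both_vpairs ein fin) E; apply: ef; apply/eqP.
Qed.

Lemma embedsE (T : finType) (e : rel T) (f : {ffun V -> T}) :
  simple_graph h -> simple_graph e ->
  (embeds h e f)%:R = \prod_(x <- vpairs) (h x.1 x.2 == e (f x.1) (f x.2))%:R :> R.
Proof.
move=> [hs hi] [es ei].
have [/embedsP E|E] := boolP (embeds h e f).
  by rewrite big1 // => x _; rewrite E eqxx.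
have /allPn [x xin /negPf xF] :
    ~~ all (fun x => h x.1 x.2 == e (f x.1) (f x.2)) vpairs.
  apply: contra E => /allP E; apply/embedsP => u v.
  have [uv|uv|uv] := ltngtP (enum_rank u) (enum_rank v).
  - by have /(_ _) /eqP := E (u, v); rewrite mem_vpairs; apply.
  - by have /(_ _) /eqP := E (v, u); rewrite mem_vpairs /= hs es; apply.
  - by move/val_inj/enum_rank_inj: uv => ->; rewrite hi ei.
by rewrite (big_rem x) //= xF mul0r.
Qed.

(** The diagonal is 0 rather than -p, so that the codegree of j and j' only sees
    the vertices i other than j and j'. *)
Definition centered (T : finType) (p : R) (e : rel T) (i j : T) : R :=
  if i == j then 0 else (e i j)%:R - p.

Lemma embeds_centered (T : finType) (e : rel T) (p : R) (f : {ffun V -> T}) :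
  simple_graph h -> simple_graph e -> injective f ->
  (embeds h e f)%:R = \prod_(x <- vpairs)
    (pair_target p x + pair_sign x * centered p e (f x.1) (f x.2)) :> R.
Proof.
move=> sh se injf; rewrite (embedsE f sh se); apply: eq_big_seq => x xin.
rewrite /centered (inj_eq injf) (negbTE (vpairs_neq xin)).
rewrite /pair_target /pair_sign.
by case: (h _ _); case: (e _ _); rewrite /=; ring.
Qed.

End Pattern.

Section ErdosRenyiCount.
Variables (R : realType) (n : nat).

Lemma prodrD_powerset (I : finType) (A : {set I}) (a b : I -> R) :
  \prod_(x in A) (a x + b x) =
  \sum_(E in powerset A) \prod_(x in A) (if x \in E then a x else b x).
Proof.
have -> : \prod_(x in A) (a x + b x) = \prod_x
    ((if x \in A then a x else 0) + (if x \in A then b x else 1)).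
  rewrite [LHS]big_mkcond; apply: eq_bigr => x _.
  by case: ifP => // _; rewrite add0r.
rewrite bigA_distr [RHS]big_mkcond /=; apply: eq_bigr => E _.
rewrite inE; case: ifPn => [/fintype.subsetP EA|/subsetPn[x xE xA]].
  rewrite [RHS]big_mkcond; apply: eq_bigr => x _.
  by have := EA x; case: (x \in E) => [->|] //; case: (x \in A).
by rewrite (bigD1 x) //= xE (negbTE xA) mul0r.
Qed.

Lemma simple_edge_rel (E : {set {set 'I_n}}) : simple_graph (edge_rel E).
Proof.
split=> [i j|i]; last by rewrite /edge_rel eqxx.
by rewrite /edge_rel eq_sym finset.setUC.
Qed.

(** The edges are independent and f sends the pairs of V to distinct pairs of
    [n]: the expectation factors over the pairs of [n], and every pair of [n]
    outside the image contributes p + (1 - p) = 1. *)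
Lemma er_expectation_embeds (V : finType) (h : rel V) (p : R)
    (f : {ffun V -> 'I_n}) : simple_graph h -> injective f ->
  er_expectation p (fun G => (embeds h G f)%:R)
  = \prod_(x <- vpairs V) pair_target h p x.
Proof.
move=> sh injf.
pose img (x : V * V) : {set 'I_n} := [set f x.1; f x.2]%SET.
have img_in x : x \in vpairs V -> img x \in vertex_pairs n.
  by move=> /vpairs_neq nx; rewrite inE cards2 (inj_eq injf) nx.
have img_inj x y : x \in vpairs V -> y \in vpairs V -> img x = img y -> x = y.
  move=> xin yin xy; apply: (meets_both_vpairs xin yin).
  have : f x.1 \in img y by rewrite -xy !inE eqxx.
  have : f x.2 \in img y by rewrite -xy !inE eqxx orbT.
  rewrite !inE !(inj_eq injf) /meets_both => H2 H1; apply/andP; split.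
    by rewrite ![_ == x.1]eq_sym.
  by rewrite ![_ == x.2]eq_sym.
have regroup (g : V * V -> R) : \prod_(x <- vpairs V) g x =
    \prod_(S in vertex_pairs n) \prod_(x <- vpairs V | img x == S) g x.
  rewrite big_seq (partition_big img (mem (vertex_pairs n))) //=.
  apply: eq_bigr => S _; rewrite [RHS]big_seq_cond; exact: eq_bigl.
pose w (b : bool) (S : {set 'I_n}) : R :=
  \prod_(x <- vpairs V | img x == S) (h x.1 x.2 == b)%:R.
transitivity (\prod_(S in vertex_pairs n) (p * w true S + (1 - p) * w false S)).
  rewrite prodrD_powerset /er_expectation; apply: eq_bigr => E _.
  rewrite (embedsE R f sh (simple_edge_rel E)) regroup /er_prob -big_split /=.
  apply: eq_bigr => S _.
  have -> : \prod_(x <- vpairs V | img x == S)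
      (h x.1 x.2 == edge_rel E (f x.1) (f x.2))%:R = w (S \in E) S.
    rewrite /w big_seq_cond [RHS]big_seq_cond; apply: eq_bigr => x.
    move=> /andP[xin /eqP <-]; rewrite /edge_rel (inj_eq injf).
    by rewrite (vpairs_neq xin).
  by case: ifP.
rewrite regroup; apply: eq_bigr => S _.
rewrite /w -!(big_filter _ (fun x => img x == S)).
set l := [seq x <- vpairs V | img x == S].
have lall x y : x \in l -> y \in l -> x = y.
  rewrite /l mem_filter [y \in _]mem_filter.
  move=> /andP[/eqP xS xin] /andP[/eqP yS yin].
  by apply: img_inj; rewrite ?xS ?yS.
have : uniq l by rewrite filter_uniq ?vpairs_uniq.
case: l lall => [|x [|y l]] lall /= lu.
- by rewrite !big_nil; ring.
- rewrite !big_seq1 /pair_target; case: (h _ _) => /=; ring.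
- by rewrite (lall x y) ?inE ?eqxx ?orbT in lu.
Qed.

Lemma er_expectation_num_induced (V : finType) (h : rel V) (p : R) :
  simple_graph h ->
  er_expectation p (fun G : rel 'I_n => (num_induced h G)%:R)
    * (num_embeddings h h)%:R =
  #|[set f : {ffun V -> 'I_n} | injectiveb f]%SET|%:R
    * \prod_(x <- vpairs V) pair_target h p x.
Proof.
move=> sh.
have -> : #|[set f : {ffun V -> 'I_n} | injectiveb f]%SET|%:R
    * \prod_(x <- vpairs V) pair_target h p x
  = \sum_(f : {ffun V -> 'I_n} | injectiveb f)
      er_expectation p (fun G => (embeds h G f)%:R).
  rewrite -sum1dep_card natr_sum mulr_suml; apply: eq_bigr => f /injectiveP injf.
  by rewrite mul1r er_expectation_embeds.
rewrite /er_expectation exchange_big mulr_suml; apply: eq_bigr => E _.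
rewrite -mulrA -natrM -num_embeddingsE -mulr_sumr; congr (_ * _).
rewrite /num_embeddings -sum1dep_card natr_sum big_mkcondr /=.
by apply: eq_bigr => f _; case: (embeds _ _ _).
Qed.

End ErdosRenyiCount.

Section RatioBound.
Variables (R : realType) (V : finType) (h : rel V) (n : nat) (G : rel 'I_n) (p : R).
Hypotheses (sh : simple_graph h) (sG : simple_graph G).
Hypotheses (p_gt0 : 0 < p) (p_lt1 : p < 1).

Let k := #|V|.
Let q : R := \prod_(x <- vpairs V) pair_target h p x.
Let weight (f : {ffun V -> 'I_n}) : R := \prod_(x <- vpairs V)
    (pair_target h p x + pair_sign R h x * centered p G (f x.1) (f x.2)).

Lemma pair_factor_le1 x i j :
  `|pair_target h p x + pair_sign R h x * centered p G i j| <= 1.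
Proof.
rewrite /pair_target /pair_sign /centered ler_norml.
have := p_gt0; have := p_lt1.
by case: (h _ _); case: eqP => _; case: (G i j); rewrite /= => *; apply/andP; split; lra.
Qed.

Lemma sum_noninjective_le :
  `|\sum_f weight f - \sum_(f : {ffun V -> 'I_n} | injectiveb f) weight f|
    <= (n ^ k)%:R - (n ^_ k)%:R.
Proof.
rewrite (bigID (fun f : {ffun V -> 'I_n} => injectiveb f)) /= addrC addrK.
have -> : (n ^ k)%:R - (n ^_ k)%:R =
    \sum_(f : {ffun V -> 'I_n} | ~~ injectiveb f) (1 : R).
  have := card_inj_ffuns V 'I_n; have := card_ffun V 'I_n.
  rewrite card_ord -/k => <- <-; rewrite -sum1dep_card -sum1_card !natr_sum.
  by rewrite (bigID (fun f : {ffun V -> 'I_n} => injectiveb f)) /= addrC addrK.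
apply: (le_trans (ler_norm_sum _ _ _)); apply: ler_sum => f _.
rewrite normr_prod; apply: prodr_ile1 => x _.
by rewrite normr_ge0 pair_factor_le1.
Qed.

(** Multiplying by the number of automorphisms turns the ratio into one of
    embedding counts. The two errors are the maps that are not injective, which
    account for n^k - n^_k terms of size at most 1, and the error of
    [sum_prod_edges] with the cut bound [cut_le_codegree]. *)
Lemma ratio_bound (delta : R) : 0 <= delta -> (k <= n)%N ->
  n%:R * (\sum_j \sum_j' `|\sum_i centered p G i j * centered p G i j'|)
    <= (delta * n%:R ^+ 2) ^+ 2 ->
  `|(num_induced h G)%:R
     / er_expectation p (fun G : rel 'I_n => (num_induced h G)%:R) - 1|
  <= (2 * ((n ^ k)%:R / (n ^_ k)%:R - 1)
      + (size (vpairs V))%:R * delta * ((n ^ k)%:R / (n ^_ k)%:R)) / q.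
Proof.
move=> d0 kn dW.
have [p0 p1] := (p_gt0, p_lt1).
have q0 : 0 < q.
  apply: prodr_gt0 => x _; rewrite /pair_target.
  by case: (h _ _); rewrite ?subr_gt0.
have q1 : q <= 1.
  apply: prodr_ile1 => x _; rewrite /pair_target.
  by case: (h _ _); apply/andP; split; lra.
pose a : R := (num_embeddings h h)%:R.
have a0 : 0 < a by rewrite ltr0n num_automorphisms_gt0.
pose D : R := (n ^_ k)%:R.
have D0 : 0 < D by rewrite ltr0n ffact_gt0.
have ND : D <= (n ^ k)%:R.
  by rewrite -subr_ge0; apply: le_trans (normr_ge0 _) sum_noninjective_le.
set N : R := (n ^ k)%:R in ND *.
pose emb := \sum_(f : {ffun V -> 'I_n} | injectiveb f) weight f.
have embE : (num_induced h G)%:R * a = emb.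
  rewrite -natrM -num_embeddingsE /num_embeddings -sum1dep_card natr_sum.
  rewrite big_mkcondr /=; apply: eq_bigr => f /injectiveP injf.
  by rewrite /weight -(embeds_centered p sh sG injf); case: (embeds _ _ _).
have := er_expectation_num_induced n p sh.
rewrite card_inj_ffuns card_ord -/k -/a -/D -/q => EE.
have -> : (num_induced h G)%:R
     / er_expectation p (fun G : rel 'I_n => (num_induced h G)%:R) - 1
   = (emb - D * q) / (D * q).
  have E0 : er_expectation p (fun G : rel 'I_n => (num_induced h G)%:R) != 0.
    apply/eqP => E0; move: EE; rewrite E0 mul0r => /esym/eqP.
    by rewrite mulf_eq0 !gt_eqF.
  by rewrite -embE -EE; field; rewrite E0 gt_eqF.
rewrite normrM normfV [`|D * q|]gtr0_norm ?mulr_gt0 // invfM mulrA.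
rewrite ler_pM2r ?invr_gt0 // ler_pdivrMr //.
have sumpi : `|\sum_f weight f - N * q| <= (size (vpairs V))%:R * (delta * N).
  have := @sum_prod_edges R V 'I_n (centered p G) delta (pair_target h p)
    (pair_sign R h) (vpairs V).
  rewrite card_ord -!natrX; apply => //.
  - move=> a' b' a1 b1; rewrite -(ler_pXn2r (n := 2)) ?nnegrE ?mulr_ge0 //.
    rewrite real_normK ?num_real // natrX; apply: le_trans dW.
    by have := cut_le_codegree (centered p G) a1 b1; rewrite card_ord.
  - move=> e; rewrite /pair_target ler_norml.
    by case: (h _ _); apply/andP; split; lra.
  - by move=> e; rewrite /pair_sign; case: (h _ _); rewrite ?normrN normr1.
  - exact: pair_factor_le1.
  - exact: vpairs_pairwise.
  - by apply/allP => e /vpairs_neq.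
have := sum_noninjective_le; rewrite -/emb -/D -/N => noninj.
have -> : emb - D * q = (N - D) * q + (\sum_f weight f - N * q)
  - (\sum_f weight f - emb) by ring.
apply: (le_trans (ler_normB _ _)).
have NDq : `|(N - D) * q| <= N - D.
  have ND0 : 0 <= N - D by rewrite subr_ge0.
  by rewrite normrM (ger0_norm ND0) gtr0_norm // ler_piMr.
have -> : (2 * (N / D - 1) + (size (vpairs V))%:R * delta * (N / D)) * D =
  2 * (N - D) + (size (vpairs V))%:R * (delta * N).
  by field; rewrite gt_eqF.
have := ler_normD ((N - D) * q) (\sum_f weight f - N * q); lra.
Qed.

End RatioBound.

(** * Means of bounded measurable functions *)

Section BoundedMeasurable.
Context {disp : measure_display} {T : measurableType disp} {R : realType}.
Implicit Types f g : T -> R.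

Definition bddmeas f : Prop :=
  measurable_fun setT f /\ exists B, forall x, `|f x| <= B.

Lemma bddmeas_cst (c : R) : bddmeas (fun=> c).
Proof. by split; [exact: measurable_cst|exists `|c|]. Qed.

Lemma bddmeasD f g : bddmeas f -> bddmeas g -> bddmeas (fun x => f x + g x).
Proof.
move=> [mf [A fA]] [mg [B gB]]; split; first exact: measurable_funD.
by exists (A + B) => x; apply: le_trans (ler_normD _ _) (lerD _ _).
Qed.

Lemma bddmeasM f g : bddmeas f -> bddmeas g -> bddmeas (fun x => f x * g x).
Proof.
move=> [mf [A fA]] [mg [B gB]]; split; first exact: measurable_funM.
by exists (A * B) => x; rewrite normrM; apply: ler_pM.
Qed.

Lemma bddmeasB f g : bddmeas f -> bddmeas g -> bddmeas (fun x => f x - g x).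
Proof.
move=> bf bg.
have -> : (fun x => f x - g x) = (fun x => f x + (-1) * g x).
  by apply/funext => x; rewrite mulN1r.
by apply: bddmeasD => //; apply: bddmeasM => //; exact: bddmeas_cst.
Qed.

Lemma bddmeasX f k : bddmeas f -> bddmeas (fun x => f x ^+ k).
Proof.
move=> [mf [B fB]]; split; first exact: measurable_funX.
by exists (B ^+ k) => x; rewrite normrX lerXn2r ?nnegrE // (le_trans _ (fB x)).
Qed.

Lemma bddmeas_norm f : bddmeas f -> bddmeas (fun x => `|f x|).
Proof.
move=> [mf [B fB]]; split; first exact: measurableT_comp.
by exists B => x; rewrite normr_id.
Qed.

Lemma bddmeas_sum (I : Type) (s : seq I) (P : pred I) (h : I -> T -> R) :
  (forall i, P i -> bddmeas (h i)) ->
  bddmeas (fun x => \sum_(i <- s | P i) h i x).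
Proof.
move=> hb; elim: s => [|i s IH].
  have -> : (fun x => \sum_(i <- [::] | P i) h i x) = fun=> 0.
    by apply/funext => x; rewrite big_nil.
  exact: bddmeas_cst.
have -> : (fun x => \sum_(j <- i :: s | P j) h j x) =
    fun x => (if P i then h i x else 0) + \sum_(j <- s | P j) h j x.
  by apply/funext => x; rewrite big_cons; case: (P i); rewrite ?add0r.
apply: bddmeasD => //; case Pi : (P i); [exact: hb|exact: bddmeas_cst].
Qed.

End BoundedMeasurable.

Lemma bddmeas_comp d1 d2 (T1 : measurableType d1) (T2 : measurableType d2)
    (R : realType) (phi : T1 -> T2) (f : T2 -> R) :
  measurable_fun setT phi -> bddmeas f -> bddmeas (fun x => f (phi x)).
Proof.
move=> mphi [mf [B fB]]; split; first exact: measurableT_comp mf mphi.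
by exists B => x.
Qed.

Lemma bddmeas_indicator d1 (T1 : measurableType d1) (R : realType)
    (b : T1 -> bool) : measurable_fun setT b ->
  bddmeas (fun x => (b x)%:R : R).
Proof.
move=> mb; split; last first.
  by exists 1 => x; case: (b x); rewrite /= ?normr1 ?normr0.
have mR : measurable_fun [set: bool] (fun c : bool => c%:R : R) by [].
exact: measurableT_comp mR mb.
Qed.

Section Expectation.
Context {disp : measure_display} {T : measurableType disp} {R : realType}.
Variable mu : probability T R.
Implicit Types f g : T -> R.

Lemma probability_lty : (mu setT < +oo)%E.
Proof. by apply: (@le_lt_trans _ _ 1%E); rewrite ?ltry // probability_le1. Qed.

Lemma bddmeas_bounded d (U : measurableType d) (h : U -> R) :
  bddmeas h -> [bounded h x | x in [set: U]].
Proof.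
move=> [_ [B hB]]; exists B; split; first exact: num_real.
by move=> M BM x _; apply: le_trans (hB x) (ltW BM).
Qed.

Lemma bddmeas_integrable f : bddmeas f -> mu.-integrable setT (EFin \o f).
Proof.
move=> bf; apply: measurable_bounded_integrable => //.
- exact: probability_lty.
- by case: bf.
- exact: bddmeas_bounded.
Qed.

Lemma meanD f g : bddmeas f -> bddmeas g ->
  \int[mu]_x (f x + g x) = \int[mu]_x f x + \int[mu]_x g x.
Proof. by move=> bf bg; apply: RintegralD => //; exact: bddmeas_integrable. Qed.

Lemma meanB f g : bddmeas f -> bddmeas g ->
  \int[mu]_x (f x - g x) = \int[mu]_x f x - \int[mu]_x g x.
Proof. by move=> bf bg; apply: RintegralB => //; exact: bddmeas_integrable. Qed.

Lemma meanZ (k : R) f : bddmeas f -> \int[mu]_x (k * f x) = k * \int[mu]_x f x.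
Proof. by move=> bf; apply: RintegralZl => //; exact: bddmeas_integrable. Qed.

Lemma mean_cst (k : R) : \int[mu]_x k = k.
Proof.
rewrite Rintegral_cst //; transitivity (k * fine 1%E); last exact: mulr1.
by congr (_ * fine _); exact: probability_setT.
Qed.

Lemma mean_sum (I : Type) (s : seq I) (P : pred I) (h : I -> T -> R) :
  (forall i, P i -> bddmeas (h i)) ->
  \int[mu]_x (\sum_(i <- s | P i) h i x) = \sum_(i <- s | P i) \int[mu]_x h i x.
Proof.
move=> hb; elim: s => [|i s IH].
  by rewrite big_nil; under eq_Rintegral do rewrite big_nil; exact: mean_cst.
rewrite big_cons; under eq_Rintegral do rewrite big_cons.
case: ifP => // Pi; rewrite meanD ?IH //; [exact: hb|exact: bddmeas_sum].
Qed.

Lemma mean_le f g : bddmeas f -> bddmeas g -> (forall x, f x <= g x) ->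
  \int[mu]_x f x <= \int[mu]_x g x.
Proof.
by move=> bf bg fg; apply: le_Rintegral => //; exact: bddmeas_integrable.
Qed.

Lemma mean_norm_le f (B : R) : bddmeas f -> (forall x, `|f x| <= B) ->
  `|\int[mu]_x f x| <= B.
Proof.
move=> bf fB.
apply: (le_trans (le_normr_Rintegral measurableT (bddmeas_integrable bf))).
rewrite -[leRHS]mean_cst; apply: mean_le => //; first exact: bddmeas_norm.
exact: bddmeas_cst.
Qed.

Lemma mean_ae f g : bddmeas f -> bddmeas g -> {ae mu, forall x, f x = g x} ->
  \int[mu]_x f x = \int[mu]_x g x.
Proof.
move=> [mf _] [mg _] fg; congr fine; apply: ae_eq_integral => //.
- exact/measurable_EFinP.
- exact/measurable_EFinP.
- by apply: filterS fg => x /= -> _.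
Qed.

End Expectation.

(** Change of variables, from equality of laws on measurable sets only; it
    serves rotations, laws of random variables and resampling. *)
Lemma mean_transport d1 d2 (T1 : measurableType d1) (T2 : measurableType d2)
    (R : realType) (m1 : {measure set T1 -> \bar R})
    (m2 : {measure set T2 -> \bar R}) (phi : T1 -> T2) (f : T2 -> R) :
  (m1 setT < +oo)%E -> measurable_fun setT phi ->
  (forall A, measurable A -> m1 (phi @^-1` A) = m2 A) -> bddmeas f ->
  \int[m2]_y f y = \int[m1]_x f (phi x).
Proof.
move=> m1f mphi m12 bf; congr fine.
rewrite -(@eq_measure_integral _ _ _ setT m2 (pushforward m1 phi)); last first.
  by move=> A mA _; rewrite -m12.
rewrite integral_pushforward //.
- by apply/measurable_EFinP; case: bf.
- rewrite preimage_setT; apply: measurable_bounded_integrable => //.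
  + by case: (bddmeas_comp mphi bf).
  + exact: bddmeas_bounded (bddmeas_comp mphi bf).
Qed.

Section ProductExpectation.
Context d1 d2 (T1 : measurableType d1) (T2 : measurableType d2) (R : realType).
Variables (m1 : probability T1 R) (m2 : probability T2 R).

Lemma product_setT : (m1 \x m2)%E setT = 1%E.
Proof.
rewrite -setXTT; apply: etrans (product_measure1E _ _ measurableT measurableT) _.
apply: etrans (congr2 mule (probability_setT m1) (probability_setT m2)) _.
exact: mule1.
Qed.

Lemma product_lty : ((m1 \x m2)%E setT < +oo)%E.
Proof. by rewrite [X in (X < _)%E]product_setT ltry. Qed.

Let integrable_prod (f : T1 * T2 -> R) : bddmeas f ->
  (m1 \x m2)%E.-integrable setT (EFin \o f).
Proof.
move=> bf; apply: measurable_bounded_integrable => //.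
- exact: product_lty.
- by case: bf.
- exact: bddmeas_bounded.
Qed.

Lemma bddmeas_section (f : T1 * T2 -> R) x :
  bddmeas f -> bddmeas (fun y => f (x, y)).
Proof. by apply: bddmeas_comp; exact: measurable_pair1. Qed.

Lemma bddmeas_mean (f : T1 * T2 -> R) : bddmeas f ->
  bddmeas (fun x => \int[m2]_y f (x, y)).
Proof.
move=> bf; split.
  apply: measurableT_comp; first exact: fine_measurable.
  exact: (measurable_fubini_F (integrable_prod bf)).
have [_ [B fB]] := bf; exists B => x; apply: mean_norm_le => //.
exact: bddmeas_section.
Qed.

Lemma mean_product (f : T1 * T2 -> R) : bddmeas f ->
  \int[(m1 \x m2)%E]_z f z = \int[m1]_x \int[m2]_y f (x, y).
Proof.
move=> bf; congr fine; rewrite -integral12_prod_meas1; last exact: integrable_prod.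
apply: eq_integral => x _; rewrite /fubini_F /= /Rintegral fineK //.
apply: integrable_fin_num => //; exact: bddmeas_integrable (bddmeas_section x bf).
Qed.

End ProductExpectation.

(** * Rotations and the kernel of a rotation-invariant law *)

Section Rotations.
Context {R : realType} {d : nat}.
Implicit Types (x y z : d.-tuple R) (Q : 'M[R]_d) (u v : 'rV[R]_d).

Definition row_of x : 'rV[R]_d := \row_i tnth x i.
Definition ip u v : R := (u *m v^T) 0 0.

Lemma ipE u v : ip u v = \sum_i u 0 i * v 0 i.
Proof. by rewrite /ip mxE; apply: eq_bigr => i _; rewrite mxE. Qed.

Lemma dotE x y : dot x y = ip (row_of x) (row_of y).
Proof. by rewrite ipE; apply: eq_bigr => i _; rewrite !mxE. Qed.

Lemma ipC u v : ip u v = ip v u.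
Proof. by rewrite !ipE; apply: eq_bigr => i _; rewrite mulrC. Qed.

Lemma dotC x y : dot x y = dot y x.
Proof. by rewrite !dotE ipC. Qed.

Lemma ipBl u v w : ip (u - v) w = ip u w - ip v w.
Proof. by rewrite /ip mulmxBl !mxE. Qed.

Lemma ipBr u v w : ip w (u - v) = ip w u - ip w v.
Proof. by rewrite ![ip w _]ipC ipBl. Qed.

Lemma ipZl a u v : ip (a *: u) v = a * ip u v.
Proof. by rewrite /ip -scalemxAl mxE. Qed.

Lemma ip_ge0 u : 0 <= ip u u.
Proof. by rewrite ipE sumr_ge0 // => i _; rewrite -expr2 sqr_ge0. Qed.

Lemma ip_eq0 u : ip u u = 0 -> u = 0.
Proof.
rewrite ipE => /eqP; rewrite psumr_eq0; last by move=> i _; rewrite -expr2 sqr_ge0.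
move=> /allP u0; apply/rowP => i; apply/eqP; rewrite mxE.
by have := u0 i (mem_index_enum _); rewrite mulf_eq0 orbb.
Qed.

Lemma row_of_act Q x : row_of (mx_act Q x) = row_of x *m Q^T.
Proof.
apply/rowP => i; rewrite !mxE tnth_mktuple; apply: eq_bigr => j _.
by rewrite !mxE mulrC.
Qed.

Lemma row_of_inj : injective row_of.
Proof.
move=> x y /rowP xy; apply: eq_from_tnth => i.
by have := xy i; rewrite !mxE.
Qed.

Definition orthogonal Q : Prop := Q *m Q^T = 1%:M.

Lemma dot_act Q x y : orthogonal Q -> dot (mx_act Q x) (mx_act Q y) = dot x y.
Proof.
move=> QQ; rewrite !dotE !row_of_act /ip trmx_mul trmxK mulmxA.
by rewrite -(mulmxA (row_of x)) (mulmx1C QQ) mulmx1.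
Qed.

Lemma orthogonalM P Q : orthogonal P -> orthogonal Q -> orthogonal (P *m Q).
Proof.
move=> PP QQ; rewrite /orthogonal trmx_mul mulmxA -(mulmxA P) QQ mulmx1.
exact: PP.
Qed.

Lemma mx_actM P Q x : mx_act (P *m Q) x = mx_act P (mx_act Q x).
Proof. by apply: row_of_inj; rewrite !row_of_act trmx_mul mulmxA. Qed.

Definition reflection v : 'M[R]_d := 1%:M - (2 / ip v v) *: (v^T *m v).

Lemma reflection_row v u :
  u *m (reflection v)^T = u - (2 * ip u v / ip v v) *: v.
Proof.
rewrite /reflection linearB /= trmx1 mulmxBr mulmx1; congr (_ - _).
rewrite linearZ /= trmx_mul trmxK -scalemxAr mulmxA.
rewrite [u *m v^T]mx11_scalar mul_scalar_mx scalerA -/(ip u v).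
by congr (_ *: _); rewrite mulrAC.
Qed.

(** For v = 0 the division by 0 makes [reflection v] the identity. *)
Lemma orthogonal_reflection v : orthogonal (reflection v).
Proof.
rewrite /orthogonal; apply/row_matrixP => i.
rewrite row_mul reflection_row row1.
have [v0|v0] := eqVneq (ip v v) 0.
  by rewrite /reflection v0 invr0 !mulr0 !scale0r !subr0 row1.
have rE : row i (reflection v) = delta_mx 0 i - (2 * v 0 i / ip v v) *: v.
  apply/rowP => j; rewrite !mxE big_ord1 !mxE eqxx /=.
  by rewrite eq_sym; field.
rewrite rE ipBl ipZl.
have -> : ip (delta_mx 0 i) v = v 0 i.
  rewrite ipE (bigD1 i) //= big1 ?mxE ?eqxx ?mul1r ?addr0 // => j ji.
  by rewrite mxE (negbTE ji) andbF mul0r.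
rewrite -addrA -opprD -scalerDl.
have -> : 2 * v 0 i / ip v v +
   2 * (v 0 i - 2 * v 0 i / ip v v * ip v v) / ip v v = 0 by field.
by rewrite scale0r subr0.
Qed.

Lemma reflection_swap u v : ip u u = ip v v ->
  u *m (reflection (u - v))^T = v.
Proof.
move=> uv; rewrite reflection_row.
have E : ip (u - v) (u - v) = 2 * ip u (u - v).
  by rewrite ipBl !ipBr -uv (ipC v u); ring.
have [w0|w0] := eqVneq (ip (u - v) (u - v)) 0.
  have := ip_eq0 w0; move/eqP; rewrite subr_eq0 => /eqP ->.
  by rewrite subrr scaler0 subr0.
by rewrite -E divff // scale1r opprB addrC subrK.
Qed.

Lemma reflection_fix u v : ip u v = 0 -> u *m (reflection v)^T = u.
Proof. by move=> uv; rewrite reflection_row uv mulr0 mul0r scale0r subr0. Qed.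

(** A reflection takes x to z. The image y of x' then has the same inner product
    with z as z', so the reflection exchanging y and z' fixes z. *)
Lemma rotate_pair x x' z z' :
  dot x x = dot z z -> dot x' x' = dot z' z' -> dot x x' = dot z z' ->
  exists Q, [/\ orthogonal Q, mx_act Q x = z & mx_act Q x' = z'].
Proof.
rewrite !dotE => xz xz' xx'.
pose P := reflection (row_of x - row_of z).
have oP : orthogonal P := orthogonal_reflection _.
pose y := mx_act P x'.
have Px : mx_act P x = z.
  by apply: row_of_inj; rewrite row_of_act reflection_swap.
have yy : ip (row_of y) (row_of y) = ip (row_of z') (row_of z').
  by rewrite -dotE dot_act // dotE.
have zy : ip (row_of z) (row_of y) = ip (row_of z) (row_of z').
  by rewrite -dotE -{1}Px dot_act // dotE xx'.
pose Q := reflection (row_of y - row_of z').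
exists (Q *m P); split; first exact: orthogonalM (orthogonal_reflection _) oP.
  rewrite mx_actM Px; apply: row_of_inj.
  by rewrite row_of_act reflection_fix // ipBr zy subrr.
by rewrite mx_actM -/y; apply: row_of_inj; rewrite row_of_act reflection_swap.
Qed.

Lemma unit_sphereP x : unit_sphere x <-> dot x x = 1.
Proof.
split=> [/(congr1 (fun r => r ^+ 2))|h]; last by rewrite /unit_sphere /= h sqrtr1.
by rewrite sqr_sqrtr ?expr1n // dotE ip_ge0.
Qed.

Lemma dot_sqr_le1 x y : dot x x = 1 -> dot y y = 1 -> dot x y ^+ 2 <= 1.
Proof.
rewrite !dotE => xx yy.
have := ip_ge0 (row_of x - ip (row_of x) (row_of y) *: row_of y).
rewrite ipBl !ipBr !ipZl ![ip _ (_ *: _)]ipC !ipZl xx yy (ipC (row_of y)).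
by move=> h; rewrite -subr_ge0; apply: le_trans h _; apply: le_of_eq; ring.
Qed.

Lemma measurable_dot d1 (T : measurableType d1) (f g : T -> d.-tuple R) :
  measurable_fun setT f -> measurable_fun setT g ->
  measurable_fun setT (fun w => dot (f w) (g w)).
Proof.
move=> /measurable_fun_tnthP mf /measurable_fun_tnthP mg.
by apply: measurable_sum => i; apply: measurable_funM; [exact: mf|exact: mg].
Qed.

Lemma measurable_mx_act Q : measurable_fun setT (mx_act Q).
Proof.
apply/measurable_fun_tnthP => i.
rewrite (_ : _ \o _ = fun x => \sum_j Q i j * tnth x j); last first.
  by apply/funext => x /=; rewrite tnth_mktuple.
apply: measurable_sum => j; apply: measurable_funM; first exact: measurable_cst.
exact: measurable_tnth.
Qed.

Lemma measurable_sphere : measurable (@unit_sphere R d).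
Proof.
have -> : @unit_sphere R d = (fun x => dot x x) @^-1` [set 1].
  by apply/funext => x; apply/propext; exact: unit_sphereP.
rewrite -[X in measurable X]setTI; apply: measurable_dot => //.
Qed.

End Rotations.

Section SimplexVectors.
Context {R : realType} {d : nat}.

(** Take z i = a e_i + b (e_0 + ... + e_m) and solve a^2 = 1 - s,
    2 a b + (m+1) b^2 = s; the discriminant of the second equation is
    1 + m s. *)
Lemma equiangular_vectors (m : nat) (s : R) :
  (m < d)%N -> s <= 1 -> 0 <= 1 + m%:R * s ->
  exists z : 'I_m.+1 -> d.-tuple R,
    forall i j, dot (z i) (z j) = if i == j then 1 else s.
Proof.
move=> md s1 ms.
pose a : R := Num.sqrt (1 - s).
have a2 : a ^+ 2 = 1 - s by rewrite sqr_sqrtr // subr_ge0.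
pose r : R := Num.sqrt (1 + m%:R * s).
have r2 : r ^+ 2 = 1 + m%:R * s by rewrite sqr_sqrtr.
(* The roots of (m+1) b^2 + 2 a b = s are (- a +- r) / (m+1). *)
pose b : R := (r - a) / m.+1%:R.
have m0 : (m.+1%:R : R) != 0 by rewrite pnatr_eq0.
have bE : 2 * (a * b) + m.+1%:R * b ^+ 2 = s.
  have -> : 2 * (a * b) + m.+1%:R * b ^+ 2 = (r ^+ 2 - a ^+ 2) / m.+1%:R.
    by rewrite /b; field.
  by rewrite r2 a2 -[m.+1]addn1 natrD; field; rewrite natr1.
pose chi (k : 'I_d) : R := (k < m.+1)%N%:R.
pose w (i : 'I_m.+1) : 'I_d := widen_ord md i.
have pick (i : 'I_m.+1) (F : 'I_d -> R) : \sum_k (k == w i)%:R * F k = F (w i).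
  rewrite (bigD1 (w i)) //= eqxx mul1r big1 ?addr0 // => k /negbTE ->.
  by rewrite mul0r.
have chi_sum : \sum_k chi k = m.+1%:R.
  transitivity (\sum_(k < d | (k < m.+1)%N) (1 : R)).
    by rewrite [RHS]big_mkcond; apply: eq_bigr => k _; rewrite /chi; case: ifP.
  by rewrite -(big_ord_widen d (fun=> 1 : R) md) sumr_const card_ord.
pose z (i : 'I_m.+1) : d.-tuple R :=
  [tuple (k == w i)%:R * a + chi k * b | k < d].
exists z => i j; rewrite /dot.
have -> : \sum_(k < d) tnth (z i) k * tnth (z j) k =
    a ^+ 2 * \sum_k (k == w i)%:R * (k == w j)%:R
    + a * b * (\sum_k (k == w i)%:R * chi k + \sum_k (k == w j)%:R * chi k)
    + b ^+ 2 * \sum_k chi k.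
  rewrite -big_split !mulr_sumr -!big_split; apply: eq_bigr => k _ /=.
  rewrite !tnth_mktuple.
  have chi2 : chi k * chi k = chi k.
    by rewrite /chi; case: (_ < _)%N; rewrite ?mulr1 ?mulr0.
  by rewrite -[in b ^+ 2 * _]chi2; ring.
have chiw l : chi (w l) = 1 by rewrite /chi /= ltn_ord.
rewrite !pick chi_sum !chiw.
have -> : (w i == w j) = (i == j) by rewrite -!val_eqE.
case: eqP => _ /=; last by rewrite -bE; ring.
have -> : a ^+ 2 * 1 + a * b * (1 + 1) + b ^+ 2 * m.+1%:R = a ^+ 2 + s.
  by rewrite -bE; ring.
by rewrite a2 subrK.
Qed.

End SimplexVectors.

Section ClippedSquare.
Context {R : realType} {d : nat}.
Notation T := (d.-tuple R).

(** Clipping keeps the square bounded off the sphere, and changes nothing on it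
    by [dot_sqr_le1]. *)
Definition clipped_sqr (x y : T) : R := Num.min (dot x y ^+ 2) 1.

Lemma clipped_sqr_ge0 x y : 0 <= clipped_sqr x y.
Proof. by rewrite le_min sqr_ge0 ler01. Qed.

Lemma clipped_sqr_le1 x y : clipped_sqr x y <= 1.
Proof. by rewrite ge_min lexx orbT. Qed.

Lemma clipped_sqr_bddmeas d1 (S : measurableType d1) (u v : S -> T) :
  measurable_fun setT u -> measurable_fun setT v ->
  bddmeas (fun s => clipped_sqr (u s) (v s)).
Proof.
move=> mu mv; split.
  apply: measurable_minr; last exact: measurable_cst.
  by apply: measurable_funX; exact: measurable_dot.
by exists 1 => s; rewrite ger0_norm ?clipped_sqr_ge0 ?clipped_sqr_le1.
Qed.

End ClippedSquare.

Section RotationInvariantLaw.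
Context {R : realType} {d : nat}.
Notation T := (d.-tuple R).
Variables (mu : probability T R) (mu_unif : uniform_on_sphere mu).

Lemma mean_act (Q : 'M[R]_d) (g : T -> R) : orthogonal Q -> bddmeas g ->
  \int[mu]_y g (mx_act Q y) = \int[mu]_y g y.
Proof.
move=> oQ bg; apply/esym/mean_transport => //.
- exact: probability_lty.
- exact: measurable_mx_act.
- by move=> A mA; case: mu_unif => _; apply.
Qed.

Lemma ae_sphere : {ae mu, forall y, dot y y = 1}.
Proof.
exists (~` unit_sphere); split.
- exact: measurableC measurable_sphere.
- rewrite probability_setC; last exact: measurable_sphere.
  by case: mu_unif => -> _; rewrite subee.
- by move=> y /= h /unit_sphereP.
Qed.

Section Kernel.
Variables (f : T -> T -> R).
Hypotheses (f_bdd : forall x, bddmeas (f x)).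
Hypothesis (f_inv : forall Q x y, orthogonal Q -> f (mx_act Q x) (mx_act Q y) = f x y).

Lemma mean_kernel_const x z : dot x x = 1 -> dot z z = 1 ->
  \int[mu]_y f x y = \int[mu]_y f z y.
Proof.
move=> xx zz; have xz := etrans xx (esym zz).
have [Q [oQ <- _]] := rotate_pair xz xz xz.
rewrite -(mean_act oQ (f_bdd (mx_act Q x))).
by congr fine; apply: eq_integral => y _; rewrite f_inv.
Qed.

Definition codegree x x' : R := \int[mu]_y (f x y * f x' y).

Lemma codegree_const x x' z z' :
  dot x x = 1 -> dot x' x' = 1 -> dot z z = 1 -> dot z' z' = 1 ->
  dot x x' = dot z z' -> codegree x x' = codegree z z'.
Proof.
move=> xx xx' zz zz' xz.
have [Q [oQ <- <-]] := rotate_pair (etrans xx (esym zz)) (etrans xx' (esym zz')) xz.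
rewrite /codegree -(mean_act oQ (bddmeasM (f_bdd (mx_act Q x)) (f_bdd _))).
by congr fine; apply: eq_integral => y _; rewrite !f_inv.
Qed.

(** The mean of (sum_i f (z i) y)^2 over equiangular vectors z i with inner
    product <x,x'> is nonnegative; it consists of m+1 diagonal terms, each at
    most 1, and of (m+1) m terms equal to the codegree of x and x'. *)
Lemma codegree_lower (m : nat) x x' : (m < d)%N ->
  dot x x = 1 -> dot x' x' = 1 -> 0 <= 1 + m%:R * dot x x' ->
  (forall y, `|f x y| <= 1) ->
  0 <= 1 + m%:R * codegree x x'.
Proof.
move=> md xx xx' ms f1; set s := dot x x' in ms.
have s1 : s <= 1.
  have := dot_sqr_le1 xx xx'; rewrite -/s => s2; rewrite leNgt; apply/negP => s1.
  have s0 : 0 <= s := le_trans ler01 (ltW s1).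
  by move: s2; rewrite leNgt expr_gt1 ?s1.
have [z zE] := equiangular_vectors md s1 ms.
have zu i : dot (z i) (z i) = 1 by rewrite zE eqxx.
have Kd i : codegree (z i) (z i) = codegree x x.
  by apply: codegree_const; rewrite ?zu.
have Ko i j : i != j -> codegree (z i) (z j) = codegree x x'.
  by move=> ij; apply: codegree_const; rewrite ?zu ?zE ?(negbTE ij).
have Kxx : codegree x x <= 1.
  rewrite /codegree -[leRHS](mean_cst mu); apply: mean_le.
  - exact: bddmeasM.
  - exact: bddmeas_cst.
  - move=> y; rewrite -expr2 -real_normK ?num_real //; exact: exprn_ile1.
have : 0 <= \int[mu]_y (\sum_i f (z i) y) ^+ 2.
  by apply: Rintegral_ge0 => y _; rewrite sqr_ge0.
have -> : \int[mu]_y (\sum_i f (z i) y) ^+ 2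
    = \sum_i \sum_j codegree (z i) (z j).
  transitivity (\int[mu]_y (\sum_i \sum_j f (z i) y * f (z j) y)).
    by congr fine; apply: eq_integral => y _; rewrite expr2 big_distrlr.
  rewrite mean_sum; last by move=> i _; apply: bddmeas_sum => j _; exact: bddmeasM.
  apply: eq_bigr => i _; rewrite mean_sum // => j _; exact: bddmeasM.
have -> : \sum_i \sum_j codegree (z i) (z j) =
    m.+1%:R * (codegree x x + m%:R * codegree x x').
  rewrite (eq_bigr (fun=> codegree x x + m%:R * codegree x x')) ?sumr_const.
    by rewrite card_ord !mulr_natl.
  move=> i _; rewrite (bigD1 i) //= Kd; congr (_ + _).
  rewrite (eq_bigr (fun=> codegree x x')) => [|j]; last first.
    by rewrite eq_sym => /Ko.
  by rewrite sumr_const cardC1 card_ord mulr_natl.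
rewrite pmulr_rge0 ?ltr0n // => h; apply: (le_trans h); exact: lerD.
Qed.

End Kernel.

(** By rotation invariance every coordinate has the same second moment, and
    on the sphere the squares of the coordinates sum to 1. *)
Lemma mean_clipped_sqr x : dot x x = 1 ->
  d%:R * \int[mu]_y clipped_sqr x y = 1.
Proof.
move=> xx; have clipped_bdd (u : T) : bddmeas (clipped_sqr u).
  by apply: clipped_sqr_bddmeas => //; exact: measurable_cst.
pose e k : T := [tuple (i == k)%:R | i < d].
have dot_e k y : dot (e k) y = tnth y k.
  rewrite /dot (bigD1 k) //= tnth_mktuple eqxx mul1r big1 ?addr0 // => i ik.
  by rewrite tnth_mktuple (negbTE ik) mul0r.
have ek k : dot (e k) (e k) = 1 by rewrite dot_e tnth_mktuple eqxx.
have inv Q (u v : T) : orthogonal Q ->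
    clipped_sqr (mx_act Q u) (mx_act Q v) = clipped_sqr u v.
  by move=> oQ; rewrite /clipped_sqr dot_act.
transitivity (\sum_(k < d) \int[mu]_y clipped_sqr (e k) y).
  rewrite (eq_bigr (fun=> \int[mu]_y clipped_sqr x y)) => [|k _].
    by rewrite sumr_const card_ord mulr_natl.
  by apply: (mean_kernel_const clipped_bdd inv).
rewrite -mean_sum; last by move=> k _; exact: clipped_bdd.
rewrite -[RHS](mean_cst mu); apply: mean_ae.
- by apply: bddmeas_sum => k _; exact: clipped_bdd.
- exact: bddmeas_cst.
apply: filterS ae_sphere => y yy; rewrite -[RHS]yy; apply: eq_bigr => k _.
rewrite /clipped_sqr dot_e min_l ?expr2 // -expr2 -(dot_e k).
exact: dot_sqr_le1.
Qed.

End RotationInvariantLaw.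

(** * Resampling one point and fourth moments *)

Section Boxes.
Context {disp : measure_display} {T : measurableType disp} {n : nat}.

Definition box (A : 'I_n -> set T) : set (n.-tuple T) :=
  [set x | forall i, A i (tnth x i)].

Definition boxes : set (set (n.-tuple T)) :=
  [set B | exists2 A, (forall i, measurable (A i)) & B = box A].

Lemma measurable_box A : (forall i, measurable (A i)) -> measurable (box A).
Proof.
move=> mA.
have -> : box A = \bigcap_(i in [set: 'I_n]) ((fun x => tnth x i) @^-1` A i).
  by apply/seteqP; split=> x /= h i; [move=> _; exact: h|exact: (h i I)].
apply: fin_bigcap_measurable => [|i _]; first exact: finite_finset.
by rewrite -[X in measurable X]setTI; exact: measurable_tnth.
Qed.

Lemma boxes_generate : @measurable _ (n.-tuple T) = <<s boxes >>.
Proof.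
apply/seteqP; split; last first.
  apply: smallest_sub; first exact: sigma_algebra_measurable.
  by move=> _ [A mA ->]; exact: measurable_box.
apply: smallest_sub; first exact: smallest_sigma_algebra.
move=> B; rewrite -bigcup_seq => -[i _] [A mA <-]; rewrite setTI.
apply: sub_sigma_algebra; exists (fun j => if j == i then A else setT).
  by move=> j; case: ifP.
apply/seteqP; split=> x /=; last by move=> /(_ i); rewrite eqxx.
by move=> Ax j; case: eqP => // ->.
Qed.

Lemma boxes_setI : setI_closed boxes.
Proof.
move=> _ _ [A mA ->] [B mB ->]; exists (fun i => A i `&` B i).
  by move=> i; exact: measurableI.
apply/seteqP; split=> x /=; first by move=> [hA hB] i; split; [exact: hA|exact: hB].
by move=> h; split=> i; case: (h i).
Qed.

Lemma boxes_setT : boxes setT.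
Proof.
by exists (fun=> setT) => //; apply/seteqP; split.
Qed.

End Boxes.

Section Resampling.
Context {R : realType} {disp disp' : measure_display}.
Context {Omega : measurableType disp} {T : measurableType disp'}.
Variables (P : probability Omega R) (n : nat) (X : 'I_n -> {RV P >-> T}).
Hypothesis X_indep : mutually_independent P (fun i => X i : Omega -> T).

Definition sample (w : Omega) : n.-tuple T := [tuple X i w | i < n].

Definition set_coord (x : n.-tuple T) (a : 'I_n) (y : T) : n.-tuple T :=
  [tuple if i == a then y else tnth x i | i < n].

Lemma tnth_set_coord x a y i : tnth (set_coord x a y) i = if i == a then y else tnth x i.
Proof. by rewrite tnth_mktuple. Qed.

Lemma measurable_sample : measurable_fun setT sample.
Proof.
apply/measurable_fun_tnthP => i; rewrite (_ : _ \o _ = X i) //.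
by apply/funext => w /=; rewrite tnth_mktuple.
Qed.

Lemma measurable_set_coord d0 (S : measurableType d0) (f : S -> n.-tuple T)
    (g : S -> T) a : measurable_fun setT f -> measurable_fun setT g ->
  measurable_fun setT (fun s => set_coord (f s) a (g s)).
Proof.
move=> /measurable_fun_tnthP mf mg; apply/measurable_fun_tnthP => i.
have [->|/negbTE ia] := eqVneq i a.
  by rewrite (_ : _ \o _ = g) //; apply/funext => s /=; rewrite tnth_set_coord eqxx.
rewrite (_ : _ \o _ = (fun s => tnth (f s) i)); first exact: mf.
by apply/funext => s /=; rewrite tnth_set_coord ia.
Qed.

Lemma law_box (A : 'I_n -> set T) (J : {set 'I_n}) :
  (forall i, measurable (A i)) ->
  P [set w | forall i, i \in J -> A i (X i w)] =
  (\prod_(i in J) P (X i @^-1` A i))%E.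
Proof.
by move=> mA; rewrite -X_indep.
Qed.

(** Independence identifies the two laws on boxes, which form a pi-system
    generating the sigma-algebra of tuples. *)
Lemma resample_law (a : 'I_n) (B : set (n.-tuple T)) : measurable B ->
  (P \x distribution P (X a))%E
    ((fun z : Omega * T => set_coord (sample z.1) a z.2) @^-1` B) =
  P (sample @^-1` B).
Proof.
pose phi (z : Omega * T) := set_coord (sample z.1) a z.2.
have mphi : measurable_fun setT phi.
  apply: measurable_set_coord => //; apply: measurableT_comp => //.
  exact: measurable_sample.
move: B; apply: (@measure_unique _ R _ boxes (fun=> setT) boxes_generate
  boxes_setI (fun=> boxes_setT) _
  (pushforward (P \x distribution P (X a))%E phi) (pushforward P sample)).
- by rewrite bigcup_const //; exists 0%N.
- exact: measurable_sample.
- move=> mS _ [A mA ->]; rewrite /pushforward.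
  transitivity ((P \x distribution P (X a))%E
    ([set w | forall i, i \in [set~ a]%SET -> A i (X i w)] `*` A a)).
    congr ((P \x distribution P (X a))%E _); apply/seteqP; split=> -[w y] /=.
      move=> h; split=> [i|]; last by have := h a; rewrite tnth_set_coord eqxx.
      rewrite !inE => /negbTE ia.
      by have := h i; rewrite tnth_set_coord ia tnth_mktuple.
    move=> [h Ay] i; rewrite tnth_set_coord; have [->//|ia] := eqVneq i a.
    by rewrite tnth_mktuple; apply: h; rewrite !inE.
  rewrite product_measure1E //; last first.
    have -> : [set w | forall i, i \in [set~ a]%SET -> A i (X i w)] =
      \bigcap_(i in [set` [set~ a]%SET]) (X i @^-1` A i).
      by apply/seteqP; split=> w /= h i; exact: h.
    apply: fin_bigcap_measurable => // i _.
    by rewrite -[X in measurable X]setTI; exact: measurable_funP.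
  transitivity ((\prod_(i in [set~ a]%SET) P (X i @^-1` A i))
      * P (X a @^-1` A a))%E.
    by congr (_ * _)%E; exact: law_box.
  transitivity (\prod_(i in [set: 'I_n]%SET) P (X i @^-1` A i))%E.
    rewrite [RHS](bigD1 a) ?inE //= [RHS]muleC; congr (_ * _)%E.
    by apply: eq_bigl => i; rewrite !inE.
  rewrite -law_box //; congr (P _); apply/seteqP; split=> w /= h i.
    by rewrite tnth_mktuple; apply: h; rewrite inE.
  by move=> _; have := h i; rewrite tnth_mktuple.
- by move=> k; exact: product_lty.
Qed.

(** Fubini for one coordinate of an independent sample: the coordinate a may be
    integrated first, with the others frozen. *)
Lemma resample (a : 'I_n) (g : n.-tuple T -> R) : bddmeas g ->
  \int[P]_w g (sample w) =
  \int[P]_w \int[distribution P (X a)]_y g (set_coord (sample w) a y).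
Proof.
move=> bg; pose phi (z : Omega * T) := set_coord (sample z.1) a z.2.
have mphi : measurable_fun setT phi.
  apply: measurable_set_coord => //; apply: measurableT_comp => //.
  exact: measurable_sample.
rewrite -(mean_product P (distribution P (X a)) (bddmeas_comp mphi bg)).
rewrite -(@mean_transport _ _ _ _ R (P \x distribution P (X a))%E
  (pushforward P sample) phi g) //; last first.
- by move=> mS B mB; exact: resample_law.
- exact: product_lty.
move=> mS; apply/esym/mean_transport => //.
- exact: probability_lty.
- exact: measurable_sample.
Qed.


Lemma sum_fourth (I : finType) (u : I -> R) :
  (\sum_i u i) ^+ 4 = \sum_a \sum_b \sum_c \sum_e u a * (u b * (u c * u e)).
Proof.
have -> : (\sum_i u i) ^+ 4 =
  (\sum_a u a) * ((\sum_b u b) * ((\sum_c u c) * (\sum_e u e))) by ring.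
rewrite mulr_suml; apply: eq_bigr => a _.
rewrite mulr_suml mulr_sumr; apply: eq_bigr => b _.
rewrite mulr_suml !mulr_sumr; apply: eq_bigr => c _.
by rewrite !mulr_sumr.
Qed.

(** After expansion, the terms in which some index occurs exactly once vanish.
    The others are those in which the four indices match in pairs, and there
    are at most 3 |I|^2 of them. *)
Lemma mean_sum_fourth_le (I : finType) (eta : I -> Omega -> R) (B : R) :
  (forall i, bddmeas (eta i)) -> (forall i w, `|eta i w| <= B) ->
  (forall a b c e, a != b -> a != c -> a != e ->
     \int[P]_w (eta a w * (eta b w * (eta c w * eta e w))) = 0) ->
  \int[P]_w (\sum_i eta i w) ^+ 4 <= 3 * #|I|%:R ^+ 2 * B ^+ 4.
Proof.
move=> be eB e0.
pose E a b c e := \int[P]_w (eta a w * (eta b w * (eta c w * eta e w))).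
have bE a b c e : bddmeas (fun w => eta a w * (eta b w * (eta c w * eta e w))).
  by do !(apply: bddmeasM; first exact: be).
have -> : \int[P]_w (\sum_i eta i w) ^+ 4 =
    \sum_a \sum_b \sum_c \sum_e E a b c e.
  transitivity (\int[P]_w \sum_a \sum_b \sum_c \sum_e
    (eta a w * (eta b w * (eta c w * eta e w)))).
    by congr fine; apply: eq_integral => w _; rewrite sum_fourth.
  rewrite mean_sum; last by move=> a _; do 3! (apply: bddmeas_sum => ? _).
  apply: eq_bigr => a _.
  rewrite mean_sum; last by move=> b _; do 2! (apply: bddmeas_sum => ? _).
  apply: eq_bigr => b _.
  rewrite mean_sum; last by move=> c _; apply: bddmeas_sum => ? _.
  by apply: eq_bigr => c _; rewrite mean_sum.
have EC a b c e : [/\ E a b c e = E b a c e, E a b c e = E c b a e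
    & E a b c e = E e b c a].
  by split; congr fine; apply: eq_integral => w _; congr EFin; ring.
have EB a b c e : E a b c e <= B ^+ 4.
  apply: (le_trans (ler_norm _)); apply: mean_norm_le => // w.
  rewrite !normrM (_ : B ^+ 4 = B * (B * (B * B))); last by ring.
  by do 3! (apply: ler_pM => //; rewrite ?mulr_ge0 ?normr_ge0 //).
have B4 : 0 <= B ^+ 4 := fourth_ge0 B.
have Ele a b c e : E a b c e <= B ^+ 4 * (((a == b) && (c == e))%:R
    + ((a == c) && (b == e))%:R + ((a == e) && (b == c))%:R).
  have paired (P1 P2 P3 : bool) : P1 || P2 || P3 ->
      E a b c e <= B ^+ 4 * (P1%:R + P2%:R + P3%:R).
    move=> h; apply: (le_trans (EB a b c e)); rewrite -{1}[B ^+ 4]mulr1.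
    apply: ler_wpM2l => //.
    by case: P1 P2 P3 h => -[] [] //= _; lra.
  have single (P1 P2 P3 : bool) : E a b c e = 0 ->
      E a b c e <= B ^+ 4 * (P1%:R + P2%:R + P3%:R).
    by move=> ->; rewrite mulr_ge0 // !addr_ge0.
  have [E1 E2 E3] := EC a b c e.
  have [ab|ab] := eqVneq a b.
    have [ce|ce] := eqVneq c e; first exact: paired.
    apply: single; have [ac|ac] := eqVneq a c.
      by rewrite E3; apply: e0; rewrite eq_sym -?ab // ac.
    by rewrite E2; apply: e0; rewrite 1?eq_sym -?ab // eq_sym.
  have [ac|ac] := eqVneq a c.
    have [be'|be'] := eqVneq b e; first exact: paired.
    by apply: single; rewrite E1; apply: e0; rewrite // eq_sym -?ac.
  have [ae|ae] := eqVneq a e; last by apply: single; exact: e0.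
  have [bc|bc] := eqVneq b c; first exact: paired.
  by apply: single; rewrite E1; apply: e0; rewrite // eq_sym -?ae.
apply: (@le_trans _ _ (\sum_a \sum_b \sum_c \sum_e
  B ^+ 4 * (((a == b) && (c == e))%:R
    + ((a == c) && (b == e))%:R + ((a == e) && (b == c))%:R))).
  by do 4! (apply: ler_sum => ? _).
have count (Q : bool) (c : I) : \sum_e (Q && (c == e))%:R = Q%:R :> R.
  rewrite (bigD1 c) //= eqxx andbT big1 ?addr0 // => e.
  by rewrite eq_sym => /negbTE ->; rewrite andbF.
have count1 (c : I) : \sum_e (c == e)%:R = 1 :> R by rewrite -[RHS](count true c).
apply: le_of_eq.
transitivity (\sum_(a in I) \sum_(b in I) B ^+ 4 * ((a == b)%:R * #|I|%:R + 1 + 1)).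
  apply: eq_bigr => a _; apply: eq_bigr => b _.
  have -> : (a == b)%:R * #|I|%:R + 1 + 1 =
      \sum_c ((a == b)%:R + (a == c)%:R + (b == c)%:R) :> R.
    by rewrite !big_split /= sumr_const !count1 mulr_natr.
  rewrite mulr_sumr; apply: eq_bigr => c _.
  rewrite -mulr_sumr !big_split /= !count; congr (_ * (_ + _ + _)).
  by rewrite -[RHS](count _ a); apply: eq_bigr => e _; rewrite andbC.
under eq_bigr do rewrite -mulr_sumr !big_split /= -mulr_suml count1 !sumr_const.
by rewrite -mulr_sumr !big_split /= !sumr_const; ring.
Qed.

Lemma bddmeas_resample (a : 'I_n) (g : n.-tuple T -> R) : bddmeas g ->
  bddmeas (fun w => \int[distribution P (X a)]_y g (set_coord (sample w) a y)).
Proof.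
move=> bg; apply: (@bddmeas_mean _ _ _ _ R P (distribution P (X a))
  (fun z => g (set_coord (sample z.1) a z.2))).
apply: bddmeas_comp bg; apply: measurable_set_coord => //.
by apply: measurableT_comp => //; exact: measurable_sample.
Qed.

(** Integrating the coordinate a first kills every product in which a occurs
    once, because the other factors do not depend on it. J holds the
    coordinates on which all the terms may depend. *)
Lemma centered_sum_fourth_moment (J : {set 'I_n})
    (psi : 'I_n -> n.-tuple T -> R) (B : R) :
  (forall i, bddmeas (psi i)) -> (forall i x, `|psi i x| <= B) ->
  (forall i x, i \in J -> psi i x = 0) ->
  (forall a b x y, a \notin J -> a != b -> psi b (set_coord x a y) = psi b x) ->
  (forall a, a \notin J -> {ae P, forall w,
     \int[distribution P (X a)]_y psi a (set_coord (sample w) a y) = 0}) ->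
  \int[P]_w (\sum_i psi i (sample w)) ^+ 4 <= 3 * n%:R ^+ 2 * B ^+ 4.
Proof.
move=> bpsi psiB psiJ psi_set psi0.
have := @mean_sum_fourth_le 'I_n (fun i w => psi i (sample w)) B.
rewrite card_ord; apply => //.
  by move=> i; apply: bddmeas_comp (bpsi i); exact: measurable_sample.
move=> a b c e ab ac ae; have [aJ|aJ] := boolP (a \in J).
  transitivity (\int[P]_w (0 : R)); last exact: mean_cst.
  by congr fine; apply: eq_integral => w _; rewrite psiJ // mul0r.
pose g x := psi a x * (psi b x * (psi c x * psi e x)).
have bg : bddmeas g by do !(apply: bddmeasM => //).
rewrite (resample a bg) -[RHS](mean_cst P).
apply: mean_ae; [exact: bddmeas_resample|exact: bddmeas_cst|].
apply: filterS (psi0 a aJ) => w psi0w.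
have bpa : bddmeas (fun y => psi a (set_coord (sample w) a y)).
  by apply: bddmeas_comp (bpsi a); apply: measurable_set_coord.
transitivity (\int[distribution P (X a)]_y
  (psi b (sample w) * (psi c (sample w) * psi e (sample w))
   * psi a (set_coord (sample w) a y))).
  congr fine; apply: eq_integral => y _; rewrite /g.
  rewrite (psi_set a b) // (psi_set a c) // (psi_set a e) //.
  by congr EFin; rewrite mulrC.
have := meanZ (distribution P (X a))
  (psi b (sample w) * (psi c (sample w) * psi e (sample w))) bpa.
by rewrite psi0w mulr0.
Qed.

End Resampling.

(** * Almost sure convergence *)

Section AlmostSure.
Context {R : realType} {disp : measure_display} {Omega : measurableType disp}.
Variable P : probability Omega R.

(** By monotone convergence the sum of the Z n has finite mean, hence is finite
    almost surely. *)
Lemma ae_cvg0_of_bounded_sums (Z : nat -> Omega -> R) (M : R) :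
  (forall n, bddmeas (Z n)) -> (forall n w, 0 <= Z n w) ->
  (forall N, \sum_(0 <= n < N) \int[P]_w Z n w <= M) ->
  {ae P, forall w, (fun n => Z n w) @ \oo --> (0 : R)}.
Proof.
move=> bZ Z0 ZM; pose S w := (\sum_(0 <= n <oo) (Z n w)%:E)%E.
have mS : measurable_fun setT S.
  apply: ge0_emeasurable_sum => [k w _ _|k _]; first by rewrite lee_fin.
  by apply/measurable_EFinP; case: (bZ k).
have S0 w : (0 <= S w)%E by apply: nneseries_ge0 => n _ _; rewrite lee_fin.
have intS : (\int[P]_w S w <= M%:E)%E.
  rewrite integral_nneseries //; last 2 first.
  - by move=> n; apply/measurable_EFinP; case: (bZ n).
  - by move=> n w _; rewrite lee_fin.
  apply: lime_le.
    by apply: is_cvg_nneseries => n _ _; apply: integral_ge0 => w _; rewrite lee_fin.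
  apply: nearW => N.
  rewrite (eq_bigr (fun n => (\int[P]_w Z n w)%:E)); last first.
    move=> n _; rewrite /Rintegral fineK //.
    by apply: integrable_fin_num => //; exact: bddmeas_integrable.
  by rewrite sumEFin lee_fin.
have iS : P.-integrable setT S.
  apply/integrableP; split=> //.
  under eq_integral do rewrite gee0_abs //.
  by apply: le_lt_trans intS _; rewrite ltry.
apply: filterS (integrable_ae measurableT iS) => w /(_ I) Sfin.
apply: cvg_series_cvg_0; apply: nondecreasing_is_cvgn.
  apply/nondecreasing_seqP => n; rewrite !seriesEnat /= big_nat_recr //=.
  by rewrite lerDl.
exists (fine (S w)) => _ [N _ <-]; rewrite -lee_fin fineK // seriesEnat /=.
rewrite -sumEFin; apply: nneseries_lim_ge => n _ _; by rewrite lee_fin.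
Qed.

Lemma ae_cvg0_inv_sqr (Z : nat -> Omega -> R) (C : R) : 0 <= C ->
  (forall n, bddmeas (Z n)) -> (forall n w, 0 <= Z n w) ->
  (forall n, (1 < n)%N -> \int[P]_w Z n w <= C / n%:R ^+ 2) ->
  {ae P, forall w, (fun n => Z n w) @ \oo --> (0 : R)}.
Proof.
move=> C0 bZ Z0 ZC.
have sums N : \sum_(0 <= n < N) \int[P]_w Z (n + 2)%N w <= C.
  (* 1 / (k+2)^2 <= 1 / (k+1) - 1 / (k+2) telescopes. *)
  apply: (@le_trans _ _ (C * (1 - N.+1%:R^-1))); last first.
    by rewrite ler_piMr // gerBl invr_ge0 ler0n.
  elim: N => [|N IH]; first by rewrite big_nil invr1 subrr mulr0.
  rewrite big_nat_recr //=; apply: (le_trans (lerD IH (ZC _ _))).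
    by rewrite addn2.
  rewrite addn2 -mulrDr; apply: ler_wpM2l => //.
  have : 0 < N.+1%:R :> R by rewrite ltr0n.
  rewrite -[N.+2]addn1 natrD; move: (N.+1%:R : R) => x x0.
  rewrite -subr_ge0.
  have -> : 1 - (x + 1)^-1 - (1 - x^-1 + ((x + 1) ^+ 2)^-1) =
      (x * (x + 1) ^+ 2)^-1.
    have x1 : x + 1 != 0 by rewrite gt_eqF // addr_gt0.
    by field; rewrite x1 gt_eqF.
  by rewrite invr_ge0 mulr_ge0 ?sqr_ge0 // ltW.
have := ae_cvg0_of_bounded_sums (fun n => bZ (n + 2)%N) (fun n => Z0 (n + 2)%N) sums.
by apply: filterS => w h; rewrite -(cvg_shiftn 2).
Qed.

End AlmostSure.

(** * The deviation of a sample *)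

Section ThresholdKernel.
Context {R : realType} {d : nat}.
Notation T := (d.-tuple R).
Variables (t p : R).

(** The kernel written f in the introduction. *)
Definition threshold_kernel (x y : T) : R := (t <= dot x y)%R%:R - p.

Lemma threshold_kernel_bddmeas d1 (S : measurableType d1) (u v : S -> T) :
  measurable_fun setT u -> measurable_fun setT v ->
  bddmeas (fun s => threshold_kernel (u s) (v s)).
Proof.
move=> mu mv; apply: bddmeasB; last exact: bddmeas_cst.
apply: bddmeas_indicator; apply: measurable_fun_ler; first exact: measurable_cst.
exact: measurable_dot.
Qed.

Lemma threshold_kernel_act Q x y : orthogonal Q ->
  threshold_kernel (mx_act Q x) (mx_act Q y) = threshold_kernel x y.
Proof. by move=> oQ; rewrite /threshold_kernel dot_act. Qed.

Lemma threshold_kernel_le1 x y : 0 <= p -> p <= 1 -> `|threshold_kernel x y| <= 1.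
Proof.
move=> p0 p1; rewrite /threshold_kernel ler_norml.
by case: (t <= _); rewrite /=; apply/andP; split; lra.
Qed.

Lemma codegree_bddmeas d1 (S : measurableType d1) (nu : probability S R)
    (mu : probability T R) (u v : S -> T) :
  measurable_fun setT u -> measurable_fun setT v ->
  bddmeas (fun s => codegree mu threshold_kernel (u s) (v s)).
Proof.
move=> mu' mv; apply: (@bddmeas_mean _ _ _ _ R nu mu
  (fun z => threshold_kernel (u z.1) z.2 * threshold_kernel (v z.1) z.2)).
by apply: bddmeasM; apply: threshold_kernel_bddmeas => //; apply: measurableT_comp.
Qed.

Lemma codegree_norm_le1 (mu : probability T R) x x' : 0 <= p -> p <= 1 ->
  `|codegree mu threshold_kernel x x'| <= 1.
Proof.
move=> p0 p1; apply: mean_norm_le => [|y].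
  by apply: bddmeasM; apply: threshold_kernel_bddmeas.
by rewrite normrM mulr_ile1 // threshold_kernel_le1.
Qed.

End ThresholdKernel.

Lemma mean_bool {R : realType} {disp : measure_display}
    {Omega : measurableType disp} (P : probability Omega R) (b : Omega -> bool) :
  measurable_fun setT b ->
  \int[P]_w (b w)%:R = fine (P [set w | b w]).
Proof.
move=> mb; have mB : measurable [set w | b w].
  by rewrite -[X in measurable X]setTI; exact: mb.
rewrite -[X in P X]setIT -integral_indic //; congr fine.
by apply: eq_integral => w _; rewrite indicE mem_setE.
Qed.

Section Deviations.
Context {R : realType} {disp : measure_display} {Omega : measurableType disp}.
Variables (P : probability Omega R) (n d : nat).
Notation T := (d.-tuple R).
Variables (X : 'I_n -> {RV P >-> T}) (t p : R).
Let f := @threshold_kernel R d t p.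
Let mu (i : 'I_n) : probability T R := distribution P (X i).

Definition degree_term (j i : 'I_n) (x : n.-tuple T) : R :=
  if i == j then 0 else f (tnth x j) (tnth x i).

Definition codegree_term (j j' i : 'I_n) (x : n.-tuple T) : R :=
  if (i == j) || (i == j') then 0
  else f (tnth x j) (tnth x i) * f (tnth x j') (tnth x i)
       - codegree (mu i) f (tnth x j) (tnth x j').

Definition square_term (j i : 'I_n) (x : n.-tuple T) : R :=
  if i == j then 0 else clipped_sqr (tnth x j) (tnth x i) - d%:R^-1.

(** The three sums measure the deviation of the degrees, of the codegrees and
    of the squared inner products; the powers of n make each of them of mean
    O(1/n^2). *)
Definition deviation (w : Omega) : R :=
  n%:R ^- 5 * (\sum_j (\sum_i degree_term j i (sample X w)) ^+ 4)
  + n%:R ^- 6 * (\sum_j \sum_j' (\sum_i codegree_term j j' i (sample X w)) ^+ 4)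
  + n%:R ^- 5 * (\sum_j (\sum_i square_term j i (sample X w)) ^+ 4).

Lemma bddmeas_degree_term j i : bddmeas (degree_term j i).
Proof.
rewrite /degree_term; case: eqP => _; first exact: bddmeas_cst.
by apply: threshold_kernel_bddmeas; exact: measurable_tnth.
Qed.

Lemma bddmeas_codegree_term j j' i : bddmeas (codegree_term j j' i).
Proof.
rewrite /codegree_term; case: (_ || _); first exact: bddmeas_cst.
apply: bddmeasB.
  by apply: bddmeasM; apply: threshold_kernel_bddmeas; exact: measurable_tnth.
apply: (@codegree_bddmeas R d t p _ _ (dirac point : probability (n.-tuple T) R));
  exact: measurable_tnth.
Qed.

Lemma bddmeas_square_term j i : bddmeas (square_term j i).
Proof.
rewrite /square_term; case: eqP => _; first exact: bddmeas_cst.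
apply: bddmeasB; last exact: bddmeas_cst.
by apply: clipped_sqr_bddmeas; exact: measurable_tnth.
Qed.

Let bddmeas_fourth (psi : 'I_n -> n.-tuple T -> R) : (forall i, bddmeas (psi i)) ->
  bddmeas (fun w => (\sum_i psi i (sample X w)) ^+ 4).
Proof.
move=> bpsi; apply: bddmeasX; apply: bddmeas_sum => i _.
by apply: bddmeas_comp (bpsi i); exact: measurable_sample.
Qed.

Lemma bddmeas_deviation : bddmeas deviation.
Proof.
apply: bddmeasD; first apply: bddmeasD; apply: bddmeasM;
  try exact: bddmeas_cst; apply: bddmeas_sum => j _.
- by apply: bddmeas_fourth => i; exact: bddmeas_degree_term.
- by apply: bddmeas_sum => j' _; apply: bddmeas_fourth => i; exact: bddmeas_codegree_term.
- by apply: bddmeas_fourth => i; exact: bddmeas_square_term.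
Qed.

Lemma deviation_ge0 w : 0 <= deviation w.
Proof.
by rewrite !addr_ge0 // mulr_ge0 ?invr_ge0 ?exprn_ge0 ?sumr_ge0 // => j _;
  rewrite ?sumr_ge0 ?fourth_ge0 // => j' _; exact: fourth_ge0.
Qed.


Hypotheses (p_ge0 : 0 <= p) (p_le1 : p <= 1) (n_gt1 : (1 < n)%N).
Hypothesis X_unif : forall i, uniform_on_sphere (distribution P (X i)).
Hypothesis X_indep : mutually_independent P (fun i => X i : Omega -> T).
Hypothesis t_prob : forall i j, i != j ->
  P [set w | t <= dot (X i w) (X j w)] = p%:E.

Lemma ae_sample_sphere : {ae P, forall w, forall i, dot (X i w) (X i w) = 1}.
Proof.
apply: filter_forall => i.
have mS : measurable (X i @^-1` unit_sphere).
  rewrite -[X in measurable X]setTI; apply: measurable_funP => //.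
  exact: measurable_sphere.
exists (~` (X i @^-1` unit_sphere)); split.
- exact: measurableC.
- have XS : P (X i @^-1` unit_sphere) = 1%E by case: (X_unif i).
  by rewrite probability_setC // XS subee.
- by move=> w /= h /unit_sphereP.
Qed.

(** By rotation invariance the mean is the same for all unit vectors x, and its
    average over the law of another point of the sample is p - p. *)
Lemma mean_threshold0 i x : dot x x = 1 -> \int[mu i]_y f x y = 0.
Proof.
move=> xx; have [j ji] : exists j, j != i.
  have := n_gt1; have [i0 _|i0 _] := eqVneq (i : nat) 0%N.
    by exists (Ordinal n_gt1); rewrite -val_eqE /= i0.
  by exists (Ordinal (ltnW n_gt1)); rewrite -val_eqE /= eq_sym.
pose g (x : n.-tuple T) := f (tnth x j) (tnth x i).
have bg : bddmeas g by apply: threshold_kernel_bddmeas; exact: measurable_tnth.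
have g0 : \int[P]_w g (sample X w) = 0.
  have mb : measurable_fun setT (fun w => t <= dot (X j w) (X i w)).
    by apply: measurable_fun_ler; [exact: measurable_cst|exact: measurable_dot].
  transitivity (\int[P]_w ((t <= dot (X j w) (X i w))%R%:R - p)).
    congr fine; apply: eq_integral => w _.
    by rewrite /g /sample !tnth_mktuple.
  rewrite meanB ?mean_cst; [|exact: bddmeas_indicator|exact: bddmeas_cst].
  by rewrite mean_bool // t_prob // subrr.
have := resample X_indep i bg; rewrite g0 => /esym E.
rewrite -[LHS](mean_cst P) -[RHS]E; apply: mean_ae.
- exact: bddmeas_cst.
- exact: bddmeas_resample.
apply: filterS ae_sample_sphere => w /(_ j) wj.
transitivity (\int[mu i]_y f (X j w) y).
  apply: (mean_kernel_const (X_unif i)) => //.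
  - move=> z; exact: (threshold_kernel_bddmeas _ _ (measurable_cst _)).
  - exact: threshold_kernel_act.
congr fine; apply: eq_integral => y _.
by rewrite /g !tnth_set_coord eqxx (negbTE ji) tnth_mktuple.
Qed.

Lemma degree_fourth_moment j :
  \int[P]_w (\sum_i degree_term j i (sample X w)) ^+ 4 <= 3 * n%:R ^+ 2.
Proof.
rewrite -[leRHS]mulr1 -[X in _ * X](expr1n _ 4).
apply: (centered_sum_fourth_moment X_indep (J := [set j]%SET)).
- exact: bddmeas_degree_term.
- move=> i x; rewrite /degree_term; case: ifP => _; first by rewrite normr0.
  exact: threshold_kernel_le1.
- by move=> i x; rewrite inE /degree_term => ->.
- move=> a b x y; rewrite inE => aj ab; rewrite /degree_term !tnth_set_coord.
  by rewrite ![_ == a]eq_sym (negbTE aj) (negbTE ab).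
- move=> a; rewrite inE => aj; apply: filterS ae_sample_sphere => w hw.
  rewrite -(mean_threshold0 a (hw j)); congr fine; apply: eq_integral => y _.
  rewrite /degree_term (negbTE aj) !tnth_set_coord eqxx [j == a]eq_sym (negbTE aj).
  by rewrite tnth_mktuple.
Qed.

Lemma codegree_fourth_moment j j' :
  \int[P]_w (\sum_i codegree_term j j' i (sample X w)) ^+ 4
  <= 3 * n%:R ^+ 2 * 2 ^+ 4.
Proof.
apply: (centered_sum_fourth_moment X_indep (J := [set j; j']%SET)).
- exact: bddmeas_codegree_term.
- move=> i x; rewrite /codegree_term; case: ifP => _; first by rewrite normr0.
  apply: (le_trans (ler_normB _ _)); rewrite -[2]/(1 + 1); apply: lerD.
    by rewrite normrM mulr_ile1 // threshold_kernel_le1.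
  exact: codegree_norm_le1.
- by move=> i x; rewrite !inE /codegree_term => ->.
- move=> a b x y; rewrite !inE negb_or => /andP[aj aj'] ab.
  rewrite /codegree_term !tnth_set_coord.
  by rewrite ![_ == a]eq_sym (negbTE aj) (negbTE aj') (negbTE ab).
- move=> a; rewrite !inE negb_or => /andP[aj aj'].
  apply: filterS ae_sample_sphere => w hw.
  pose K := codegree (mu a) f (X j w) (X j' w).
  transitivity (\int[mu a]_y (f (X j w) y * f (X j' w) y - K)).
    congr fine; apply: eq_integral => y _.
    rewrite /codegree_term (negbTE aj) (negbTE aj') !tnth_set_coord eqxx.
    rewrite ![_ == a]eq_sym (negbTE aj) (negbTE aj') /=.
    by rewrite !tnth_mktuple.
  rewrite meanB ?mean_cst; first by rewrite subrr.
  + by apply: bddmeasM; apply: threshold_kernel_bddmeas => //; exact: measurable_cst.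
  + exact: bddmeas_cst.
Qed.

Lemma square_fourth_moment j : (0 < d)%N ->
  \int[P]_w (\sum_i square_term j i (sample X w)) ^+ 4 <= 3 * n%:R ^+ 2.
Proof.
move=> d0; rewrite -[leRHS]mulr1 -[X in _ * X](expr1n _ 4).
apply: (centered_sum_fourth_moment X_indep (J := [set j]%SET)).
- exact: bddmeas_square_term.
- move=> i x; rewrite /square_term; case: ifP => _; first by rewrite normr0.
  have s0 := clipped_sqr_ge0 (tnth x j) (tnth x i).
  have s1 := clipped_sqr_le1 (tnth x j) (tnth x i).
  have d1 : (d%:R : R)^-1 <= 1 by rewrite invf_le1 ?ltr0n // ler1n.
  have d2 : 0 <= (d%:R : R)^-1 by rewrite invr_ge0.
  by rewrite ler_norml; apply/andP; split; lra.
- by move=> i x; rewrite inE /square_term => ->.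
- move=> a b x y; rewrite inE => aj ab; rewrite /square_term !tnth_set_coord.
  by rewrite ![_ == a]eq_sym (negbTE aj) (negbTE ab).
- move=> a; rewrite inE => aj; apply: filterS ae_sample_sphere => w hw.
  transitivity (\int[mu a]_y (clipped_sqr (X j w) y - d%:R^-1)).
    congr fine; apply: eq_integral => y _.
    rewrite /square_term (negbTE aj) !tnth_set_coord eqxx [j == a]eq_sym (negbTE aj).
    by rewrite tnth_mktuple.
  rewrite meanB ?mean_cst; last exact: bddmeas_cst; last first.
    by apply: clipped_sqr_bddmeas => //; exact: measurable_cst.
  have := mean_clipped_sqr (X_unif a) (hw j).
  have dR : (d%:R : R) != 0 by rewrite pnatr_eq0 -lt0n.
  move=> /(canRL (mulKf dR)); rewrite mulr1 => ->; exact: subrr.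
Qed.

Lemma mean_deviation_le : (0 < d)%N -> \int[P]_w deviation w <= 54 / n%:R ^+ 2.
Proof.
move=> d0; have n0 : 0 < n%:R :> R by rewrite ltr0n ltnW.
have b1 j := bddmeas_fourth (bddmeas_degree_term j).
have b2 j j' := bddmeas_fourth (bddmeas_codegree_term j j').
have b3 j := bddmeas_fourth (bddmeas_square_term j).
have B1 := bddmeas_sum (index_enum 'I_n) (fun j (_ : true) => b1 j).
have B2 := bddmeas_sum (index_enum 'I_n) (fun j (_ : true) =>
  bddmeas_sum (index_enum 'I_n) (fun j' (_ : true) => b2 j j')).
have B3 := bddmeas_sum (index_enum 'I_n) (fun j (_ : true) => b3 j).
have sumI (c : R) : \sum_(j < n) c = n%:R * c.
  by rewrite sumr_const card_ord mulr_natl.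
rewrite /deviation meanD; first last.
- by apply: bddmeasM B3; exact: bddmeas_cst.
- by apply: bddmeasD; apply: bddmeasM => //; exact: bddmeas_cst.
rewrite meanD; first last.
- by apply: bddmeasM B2; exact: bddmeas_cst.
- by apply: bddmeasM B1; exact: bddmeas_cst.
rewrite !meanZ // !mean_sum //; last first.
  by move=> j _; apply: bddmeas_sum => j' _; exact: b2.
have i1 : n%:R ^- 5 * \sum_(j < n) \int[P]_w (\sum_i degree_term j i (sample X w)) ^+ 4
    <= 3 / n%:R ^+ 2.
  apply: (@le_trans _ _ (n%:R ^- 5 * \sum_(j < n) (3 * n%:R ^+ 2))).
    rewrite ler_pM2l ?invr_gt0 ?exprn_gt0 //.
    by apply: ler_sum => j _; exact: degree_fourth_moment.
  by rewrite sumI; apply: le_of_eq; field; rewrite gt_eqF.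
have i3 : n%:R ^- 5 * \sum_(j < n) \int[P]_w (\sum_i square_term j i (sample X w)) ^+ 4
    <= 3 / n%:R ^+ 2.
  apply: (@le_trans _ _ (n%:R ^- 5 * \sum_(j < n) (3 * n%:R ^+ 2))).
    rewrite ler_pM2l ?invr_gt0 ?exprn_gt0 //.
    by apply: ler_sum => j _; exact: square_fourth_moment.
  by rewrite sumI; apply: le_of_eq; field; rewrite gt_eqF.
have i2 : n%:R ^- 6 * \sum_(j < n) \int[P]_w
      (\sum_j' (\sum_i codegree_term j j' i (sample X w)) ^+ 4)
    <= 48 / n%:R ^+ 2.
  apply: (@le_trans _ _ (n%:R ^- 6 * \sum_(j < n) \sum_(j' < n) (3 * n%:R ^+ 2 * 2 ^+ 4))).
    rewrite ler_pM2l ?invr_gt0 ?exprn_gt0 //.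
    apply: ler_sum => j _; rewrite mean_sum //.
    by apply: ler_sum => j' _; exact: codegree_fourth_moment.
  by rewrite !sumI; apply: le_of_eq; field; rewrite gt_eqF.
apply: (le_trans (lerD (lerD i1 i2) i3)).
by rewrite -!mulrDl; apply: le_of_eq; ring.
Qed.

End Deviations.

(** * The sum of the codegrees *)

Section Young.
Variable R : realFieldType.

Lemma norm_le_fourth (e v : R) : 0 < e -> `|v| <= e + v ^+ 4 / e ^+ 3.
Proof.
move=> e0; have e3 : 0 < e ^+ 3 by rewrite exprn_gt0.
have [ve|ve] := lerP `|v| e.
  by apply: (le_trans ve); rewrite lerDl divr_ge0 ?fourth_ge0 // ltW.
have -> : v ^+ 4 = `|v| ^+ 4.
  by rewrite -[4%N]/(2 * 2)%N !exprM real_normK ?num_real.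
apply: (@le_trans _ _ (`|v| ^+ 4 / e ^+ 3)); last by rewrite lerDr ltW.
rewrite ler_pdivlMr // [leRHS]exprS ler_wpM2l //.
by rewrite lerXn2r ?nnegrE ?(ltW e0) // ltW.
Qed.

Lemma sqr_le_fourth (e v : R) : 0 < e -> e <= 1 -> v ^+ 2 <= e + v ^+ 4 / e ^+ 3.
Proof.
move=> e0 e1; have e3 : 0 < e ^+ 3 by rewrite exprn_gt0.
have [ve|ve] := lerP (v ^+ 2) e.
  by apply: (le_trans ve); rewrite lerDl divr_ge0 ?fourth_ge0 // ltW.
apply: (@le_trans _ _ (v ^+ 4 / e ^+ 3)); last by rewrite lerDr ltW.
rewrite ler_pdivlMr // -[4%N]/(2 + 2)%N exprD ler_wpM2l ?sqr_ge0 //.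
apply: le_trans (ltW ve); rewrite exprS -[leRHS]mulr1 ler_wpM2l ?(ltW e0) //.
by rewrite exprn_ile1 ?(ltW e0).
Qed.

End Young.

Lemma simple_geometric_graph (R : realType) (n d : nat) (t : R)
    (x : 'I_n -> d.-tuple R) : simple_graph (geometric_graph t x).
Proof.
split=> [i j|i]; last by rewrite /geometric_graph eqxx.
by rewrite /geometric_graph eq_sym dotC.
Qed.

Section CodegreeSum.
Context {R : realType} {disp : measure_display} {Omega : measurableType disp}.
Variables (P : probability Omega R) (n d : nat).
Notation T := (d.-tuple R).
Variables (X : 'I_n -> {RV P >-> T}) (t p : R).

(** Write c for the codegree of j and j', and b for a bound on -c. Then
    |c| <= c + 2 b. The c sum to sum_i (sum_j F i j)^2, and b comes from the
    fluctuation of c around its conditional mean together with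
    [codegree_lower], which applies unless m <x,x'> < -1, and then
    m^2 <x,x'>^2 >= 1. The sums of absolute values and of squares are reduced
    to the fourth powers of [deviation] by [norm_le_fourth] and
    [sqr_le_fourth], whose parameter e is free. *)
Lemma codegree_sum_le (w : Omega) (m : nat) (e : R) :
  0 <= p -> p <= 1 -> (0 < n)%N ->
  (forall i, uniform_on_sphere (distribution P (X i))) ->
  (forall i, dot (X i w) (X i w) = 1) ->
  (0 < m < d)%N -> 0 < e -> e <= 1 ->
  let F := centered p (geometric_graph t (fun i => X i w)) in
  \sum_j \sum_j' `|\sum_i F i j * F i j'| <=
  n%:R ^+ 3 * (2 / m%:R + 2 * m%:R ^+ 2 / d%:R
    + (3 + 2 * m%:R ^+ 2) * (e + deviation X t p w / e ^+ 3)).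
Proof.
move=> p0 p1 n0 unif hw /andP[m0 md] e0 e1 /=.
set F := centered p _.
have nR : 0 < n%:R :> R by rewrite ltr0n.
have mR : 0 < m%:R :> R by rewrite ltr0n.
have dR : 0 < d%:R :> R by rewrite ltr0n (ltn_trans m0).
pose x := sample X w; pose Z := deviation X t p w.
have xE i : tnth x i = X i w by rewrite tnth_mktuple.
pose f := @threshold_kernel R d t p.
have FE i j : F i j = if i == j then 0 else f (X i w) (X j w).
  by rewrite /F /centered /geometric_graph; case: eqP.
have FC i j : F i j = F j i.
  by rewrite !FE eq_sym /f /threshold_kernel dotC.
pose c j j' := \sum_i F i j * F i j'.
pose N j j' := \sum_i codegree_term X t p j j' i x.
pose v j := \sum_i degree_term t p j i x.
pose u j := \sum_i square_term j i x.
pose s j j' : R := if j' == j then 0 else clipped_sqr (X j w) (X j' w).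
have [Zv ZN Zu] : [/\ \sum_j v j ^+ 4 <= n%:R ^+ 5 * Z,
    \sum_j \sum_j' N j j' ^+ 4 <= n%:R ^+ 6 * Z
    & \sum_j u j ^+ 4 <= n%:R ^+ 5 * Z].
  have v0 : 0 <= n%:R ^- 5 * \sum_j v j ^+ 4.
    by rewrite mulr_ge0 ?invr_ge0 ?exprn_ge0 // sumr_ge0 // => j _; exact: fourth_ge0.
  have N0 : 0 <= n%:R ^- 6 * \sum_j \sum_j' N j j' ^+ 4.
    rewrite mulr_ge0 ?invr_ge0 ?exprn_ge0 // sumr_ge0 // => j _.
    by rewrite sumr_ge0 // => j' _; exact: fourth_ge0.
  have u0 : 0 <= n%:R ^- 5 * \sum_j u j ^+ 4.
    by rewrite mulr_ge0 ?invr_ge0 ?exprn_ge0 // sumr_ge0 // => j _; exact: fourth_ge0.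
  have ZE : Z = n%:R ^- 5 * (\sum_j v j ^+ 4)
    + n%:R ^- 6 * (\sum_j \sum_j' N j j' ^+ 4) + n%:R ^- 5 * (\sum_j u j ^+ 4) by [].
  by split; rewrite -ler_pdivrMl ?exprn_gt0 // ZE; lra.
have pointwise j j' : `|c j j'| <= c j j'
    + 2 * (`|N j j'| + n%:R * (m%:R^-1 + m%:R ^+ 2 * s j j')).
  have b0 : 0 <= `|N j j'| + n%:R * (m%:R^-1 + m%:R ^+ 2 * s j j').
    rewrite addr_ge0 ?mulr_ge0 ?addr_ge0 ?invr_ge0 ?mulr_ge0 ?exprn_ge0 ?(ltW mR) //.
    rewrite /s; case: ifP => // _; exact: clipped_sqr_ge0.
  set b := `|N j j'| + _ in b0 *.
  suff cb : - c j j' <= b.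
    by have [c0|c0] := lerP 0 (c j j'); [rewrite ger0_norm|rewrite ltr0_norm] => //; lra.
  have [jj|jj] := eqVneq j' j.
    apply: le_trans b0; rewrite oppr_le0 sumr_ge0 // => i _.
    by rewrite jj -expr2 sqr_ge0.
  (* The conditional mean of the i-th term of c, given X j and X j'. *)
  pose K i : R := if (i == j) || (i == j') then 0 else
    codegree (distribution P (X i)) f (X j w) (X j' w).
  have cE : c j j' = N j j' + \sum_i K i.
    rewrite -big_split /=; apply: eq_bigr => i _.
    rewrite /codegree_term /K !xE FC [F i j']FC !FE ![_ == i]eq_sym.
    case: eqP => _ /=; first by rewrite mul0r addr0.
    by case: eqP => _; rewrite ?mulr0 ?addr0 // subrK.
  have Klow i : - K i <= m%:R^-1 + m%:R ^+ 2 * s j j'.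
    have s0 : 0 <= m%:R ^+ 2 * s j j'.
      rewrite mulr_ge0 ?sqr_ge0 // /s; case: ifP => // _; exact: clipped_sqr_ge0.
    have i0 : 0 < (m%:R : R)^-1 by rewrite invr_gt0.
    rewrite /K; case: ifP => _; first by rewrite oppr0 addr_ge0 // ltW.
    set k := codegree _ _ _ _.
    have [ms|ms] := lerP 0 (1 + m%:R * dot (X j w) (X j' w)).
      have : 0 <= 1 + m%:R * k.
        apply: (codegree_lower (unif i) _ _ md (hw j) (hw j') ms).
        - by move=> z; apply: threshold_kernel_bddmeas => //; exact: measurable_cst.
        - exact: threshold_kernel_act.
        - by move=> y; exact: threshold_kernel_le1.
      rewrite -(pmulr_rge0 _ i0) mulrDr mulr1 mulKf ?gt_eqF // => h; lra.
    have k1 : - k <= 1.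
      by rewrite (le_trans (ler_norm _)) // normrN; exact: codegree_norm_le1.
    apply: (le_trans k1); apply: (@le_trans _ _ (m%:R ^+ 2 * s j j')); last by lra.
    rewrite /s (negbTE jj) /clipped_sqr min_l; last exact: dot_sqr_le1.
    rewrite -exprMn -[leLHS](expr1n _ 2) -[leRHS]sqrrN.
    by rewrite lerXn2r ?nnegrE; lra.
  rewrite cE opprD; apply: lerD.
    by rewrite -normrN ler_norm.
  rewrite -sumrN; apply: (le_trans (ler_sum _ (fun i _ => Klow i))).
  by rewrite sumr_const card_ord mulr_natl.
have sumI (a : R) : \sum_(j < n) a = n%:R * a.
  by rewrite sumr_const card_ord mulr_natl.
pose y := e + Z / e ^+ 3.
have e3 : 0 < e ^+ 3 by rewrite exprn_gt0.
have cv : \sum_j \sum_j' c j j' <= n%:R ^+ 3 * y.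
  have -> : \sum_j \sum_j' c j j' = \sum_i v i ^+ 2.
    under [RHS]eq_bigr do rewrite expr2 big_distrlr /=.
    rewrite [RHS]exchange_big /=; apply: eq_bigr => j _.
    rewrite [RHS]exchange_big /=; apply: eq_bigr => j' _.
    apply: eq_bigr => i _; rewrite !FE /degree_term !xE.
    by rewrite ![i == _]eq_sym.
  apply: (@le_trans _ _ (\sum_i (n%:R ^+ 2 * e + n%:R ^- 2 / e ^+ 3 * v i ^+ 4))).
    apply: ler_sum => i _; have h := sqr_le_fourth (v i / n%:R) e0 e1.
    rewrite -(ler_pM2l (exprn_gt0 2 nR)) in h.
    have -> : v i ^+ 2 = n%:R ^+ 2 * (v i / n%:R) ^+ 2 by field; rewrite gt_eqF.
    apply: (le_trans h); apply: le_of_eq.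
    by field; rewrite !gt_eqF.
  rewrite big_split /= sumI -mulr_sumr.
  have -> : n%:R ^+ 3 * y = n%:R * (n%:R ^+ 2 * e)
    + n%:R ^- 2 / e ^+ 3 * (n%:R ^+ 5 * Z) by rewrite /y; field; rewrite !gt_eqF.
  by rewrite lerD2l ler_wpM2l // divr_ge0 ?invr_ge0 ?exprn_ge0 // ltW.
have cN : \sum_j \sum_j' `|N j j'| <= n%:R ^+ 3 * y.
  apply: (@le_trans _ _ (\sum_j \sum_j'
      (n%:R * e + n%:R ^- 3 / e ^+ 3 * N j j' ^+ 4))).
    apply: ler_sum => j _; apply: ler_sum => j' _.
    have h := norm_le_fourth (N j j' / n%:R) e0.
    rewrite -(ler_pM2l nR) normrM [`|_^-1|]gtr0_norm ?invr_gt0 // in h.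
    have -> : `|N j j'| = n%:R * (`|N j j'| / n%:R) by field; rewrite gt_eqF.
    apply: (le_trans h); apply: le_of_eq.
    by field; rewrite !gt_eqF.
  under eq_bigr do rewrite big_split /= sumI -mulr_sumr.
  rewrite big_split /= sumI -mulr_sumr.
  have -> : n%:R ^+ 3 * y = n%:R * (n%:R * (n%:R * e))
    + n%:R ^- 3 / e ^+ 3 * (n%:R ^+ 6 * Z) by rewrite /y; field; rewrite !gt_eqF.
  by rewrite lerD2l ler_wpM2l // divr_ge0 ?invr_ge0 ?exprn_ge0 // ltW.
have cs : \sum_j \sum_j' s j j' <= n%:R ^+ 2 * (d%:R^-1 + y).
  apply: (@le_trans _ _ (\sum_j (n%:R * (d%:R^-1 + e) + n%:R ^- 3 / e ^+ 3 * u j ^+ 4))).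
    apply: ler_sum => j _.
    apply: (@le_trans _ _ (n%:R / d%:R + `|u j|)).
      apply: (@le_trans _ _ (\sum_j' (d%:R^-1 + square_term j j' x))).
        apply: ler_sum => j' _; rewrite /s /square_term !xE.
        by case: eqP => _; rewrite ?addr0 ?invr_ge0 ?(ltW dR) // addrC subrK.
      by rewrite big_split /= sumI lerD2l ler_norm.
    have h := norm_le_fourth (u j / n%:R) e0.
    rewrite -(ler_pM2l nR) normrM [`|_^-1|]gtr0_norm ?invr_gt0 // in h.
    have -> : `|u j| = n%:R * (`|u j| / n%:R) by field; rewrite gt_eqF.
    rewrite mulrDr -addrA lerD2l; apply: (le_trans h).
    apply: le_of_eq.
    by field; rewrite !gt_eqF.
  rewrite big_split /= sumI -mulr_sumr.
  have -> : n%:R ^+ 2 * (d%:R^-1 + y) = n%:R * (n%:R * (d%:R^-1 + e))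
    + n%:R ^- 3 / e ^+ 3 * (n%:R ^+ 5 * Z) by rewrite /y; field; rewrite !gt_eqF.
  by rewrite lerD2l ler_wpM2l // divr_ge0 ?invr_ge0 ?exprn_ge0 // ltW.
apply: (le_trans (ler_sum _ (fun j _ => ler_sum _ (fun j' _ => pointwise j j')))).
have -> : \sum_j \sum_j' (c j j' +
      2 * (`|N j j'| + n%:R * (m%:R^-1 + m%:R ^+ 2 * s j j'))) =
    \sum_j \sum_j' c j j' + 2 * (\sum_j \sum_j' `|N j j'|
      + n%:R * (n%:R ^+ 2 / m%:R + m%:R ^+ 2 * \sum_j \sum_j' s j j')).
  have lin (h1 h2 h3 : 'I_n -> R) (a b : R) : \sum_j (h1 j + 2 *
      (h2 j + n%:R * (a + m%:R ^+ 2 * h3 j))) = \sum_j h1 j + 2 *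
      (\sum_j h2 j + n%:R * (n%:R * a + m%:R ^+ 2 * \sum_j h3 j)).
    rewrite big_split /= -mulr_sumr big_split /= -mulr_sumr big_split /=.
    by rewrite sumI -mulr_sumr.
  under eq_bigr do rewrite lin //.
  by rewrite lin // expr2 mulrA.
apply: (@le_trans _ _ (n%:R ^+ 3 * y + 2 * (n%:R ^+ 3 * y
      + n%:R * (n%:R ^+ 2 / m%:R + m%:R ^+ 2 * (n%:R ^+ 2 * (d%:R^-1 + y)))))).
  apply: lerD => //; rewrite ler_pM2l //; apply: lerD => //.
  by rewrite ler_pM2l // lerD2l ler_wpM2l // sqr_ge0.
rewrite -/Z -/y; apply: le_of_eq.
by field; rewrite !gt_eqF.
Qed.

End CodegreeSum.

(** * The limit *)

Lemma sphere_dim_gt0 (R : realType) (d : nat)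
    (mu : {measure set (d.-tuple R) -> \bar R}) :
  uniform_on_sphere mu -> (0 < d)%N.
Proof.
case: d mu => // mu [mu1 _]; have S0 : @unit_sphere R 0 = set0.
  apply/seteqP; split=> // x /unit_sphereP; rewrite /dot big_ord0 => /esym/eqP.
  by rewrite oner_eq0.
by move: mu1; rewrite S0 measure0 => /eqP; rewrite eqe eq_sym oner_eq0.
Qed.

Lemma cvg_expn_ffact (R : realType) (k : nat) :
  (fun n : nat => (n ^ k)%:R / (n ^_ k)%:R : R) @ \oo --> (1 : R).
Proof.
elim: k => [|k IH].
  rewrite (_ : (fun n : nat => _) = fun=> (1 : R)); first exact: cvg_cst.
  by apply/funext => n; rewrite expn0 ffactn0 divr1.
rewrite (_ : (fun n : nat => _) =
  (fun n => ((n ^ k)%:R / (n ^_ k)%:R) * (n%:R / (n - k)%:R) : R)); last first.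
  by apply/funext => n; rewrite expnSr ffactnSr !natrM invfM mulrACA.
rewrite -[X in _ --> X]mulr1; apply: cvgM => //.
have lim1 : (fun n => 1 + k%:R * harmonic n : R) @ \oo --> (1 : R).
  rewrite -[X in _ --> X]addr0 -[X in _ + X](mulr0 (k%:R : R)).
  apply: cvgD; first exact: cvg_cst.
  by apply: cvgM; [exact: cvg_cst|exact: cvg_harmonic].
rewrite -(cvg_shiftn k.+1).
rewrite (_ : (fun n : nat => _) = (fun n => 1 + k%:R * harmonic n : R)) //.
apply/funext => n /=; rewrite addnS -addSn addnK natrD mulrDl divff //.
Qed.

Lemma dim_unbounded (R : realType) (d : nat -> nat) :
  (fun n : nat => (d n)%:R / ln (n%:R : R)) @ \oo --> +oo ->
  forall D : nat, \forall n \near \oo, (D <= d n)%N.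
Proof.
move=> /cvgryPge h D; have hD := h D%:R.
near=> n.
have ln1 : 1 <= ln (n%:R : R).
  have en : expR 1 <= n%:R :> R by near: n; exact: nbhs_infty_ger.
  have n0 : 0 < n%:R :> R := lt_le_trans (expR_gt0 1) en.
  by rewrite -[leLHS](expRK 1) ler_ln ?posrE ?expR_gt0.
have : D%:R <= (d n)%:R / ln (n%:R : R) by near: n.
rewrite -(ler_nat R) => /le_trans; apply.
by rewrite ler_pdivrMr ?(lt_le_trans ltr01) // ler_peMr.
Unshelve. all: by end_near.
Qed.

Lemma codegree_sum_cvg0 (R : realType) (W Z : nat -> R) (d : nat -> nat) :
  (forall n, 0 <= W n) -> Z @ \oo --> (0 : R) ->
  (forall D : nat, \forall n \near \oo, (D <= d n)%N) ->
  (forall n m e, (1 < n)%N -> (0 < m < d n)%N -> 0 < e -> e <= 1 ->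
    W n <= n%:R ^+ 3 * (2 / m%:R + 2 * m%:R ^+ 2 / (d n)%:R
      + (3 + 2 * m%:R ^+ 2) * (e + Z n / e ^+ 3))) ->
  (fun n => W n / n%:R ^+ 3) @ \oo --> (0 : R).
Proof.
move=> W0 Z0 dinf Wle; apply/cvgrPdist_le => eps eps0.
pose a : R := eps / 4; have a0 : 0 < a by rewrite divr_gt0.
have [m m0 ma] : exists2 m : nat, (0 < m)%N & 2 / m%:R <= a.
  exists (Num.truncn (2 / a)).+1 => //.
  rewrite ler_pdivrMr ?ltr0n // mulrC -ler_pdivrMr // ltW //.
  exact: truncnS_gt.
pose b : R := 3 + 2 * m%:R ^+ 2.
have b0 : 0 < b by rewrite ltr_wpDr // mulr_ge0 ?sqr_ge0.
pose e : R := Num.min 1 (a / b).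
have e0 : 0 < e by rewrite lt_min ltr01 divr_gt0.
have e1 : e <= 1 by rewrite ge_min lexx.
have be : b * e <= a by rewrite mulrC -ler_pdivlMr // ge_min lexx orbT.
have e3 : 0 < e ^+ 3 by rewrite exprn_gt0.
have c0 : 0 < a * e ^+ 3 / b by rewrite divr_gt0 // mulr_gt0.
have Zsmall : \forall n \near \oo, `|Z n| <= a * e ^+ 3 / b.
  by move/cvgr0Pnorm_le : Z0 => /(_ _ c0).
near=> n.
have n1 : (1 < n)%N by near: n; exact: nbhs_infty_gt.
have nR : 0 < n%:R ^+ 3 :> R by rewrite exprn_gt0 // ltr0n ltnW.
have md : (m < d n)%N by near: n; exact: dinf.
have dR : 0 < (d n)%:R :> R by rewrite ltr0n (ltn_trans m0).
have dm : 2 * m%:R ^+ 2 / (d n)%:R <= a.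
  rewrite ler_pdivrMr // [leRHS]mulrC -ler_pdivrMr //.
  apply: (@le_trans _ _ (Num.truncn (2 * m%:R ^+ 2 / a)).+1%:R).
    by apply/ltW; exact: truncnS_gt.
  by rewrite ler_nat; near: n; exact: dinf.
have Zn : `|Z n| <= a * e ^+ 3 / b.
  by near: n; exact: Zsmall.
have bZ : b * (Z n / e ^+ 3) <= a.
  rewrite mulrA ler_pdivrMr // [leLHS]mulrC -ler_pdivlMr //.
  exact: le_trans (ler_norm _) Zn.
rewrite sub0r normrN ger0_norm ?divr_ge0 ?(ltW nR) //.
rewrite ler_pdivrMr // [leRHS]mulrC.
have mdn : (0 < m < d n)%N by rewrite m0.
apply: (le_trans (Wle n m e n1 mdn e0 e1)); rewrite ler_pM2l //.
rewrite -/b mulrDr; have -> : eps = a + a + (a + a) by rewrite /a; field.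
by rewrite !lerD.
Unshelve. all: by end_near.
Qed.

Theorem theorem2p4 (R : realType) (disp : measure_display)
    (Omega : measurableType disp) (P : probability Omega R)
    (p : R) (d : nat -> nat)
    (X : forall n : nat, 'I_n -> {RV P >-> (d n).-tuple R})
    (t : nat -> R)
    (p_gt0 : 0 < p) (p_le_half : p <= 2^-1)
    (X_unif : forall (n : nat) (i : 'I_n),
       uniform_on_sphere (distribution P (X n i)))
    (X_indep : forall n : nat,
       mutually_independent P (fun i : 'I_n => X n i : Omega -> (d n).-tuple R))
    (t_prob : forall (n : nat) (i j : 'I_n), i != j ->
       P [set w | t (d n) <= dot (X n i w) (X n j w)] = p%:E)
    (d_log : (fun n : nat => (d n)%:R / ln (n%:R : R)) @ \oo --> +oo)
    (d_logc : exists2 c : R, 1 < c &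
       (fun n : nat => ln (n%:R : R) `^ c / (d n)%:R) @ \oo --> (0 : R)) :
  forall (V : finType) (H : rel V), simple_graph H ->
  {ae P, forall w : Omega,
    (fun n : nat =>
       `| (num_induced H
             (geometric_graph (t (d n)) (fun i : 'I_n => X n i w)))%:R
          / er_expectation p (fun G : rel 'I_n => (num_induced H G)%:R)
          - 1 |) @ \oo --> (0 : R)}.
Proof.
move=> V H sH.
have p0 : 0 <= p := ltW p_gt0.
have p1 : p < 1 by apply: le_lt_trans p_le_half _; rewrite invf_lt1 // ltr1n.
pose Z (n : nat) : Omega -> R := deviation (X n) (t (d n)) p.
have Zcvg : {ae P, forall w, (fun n => Z n w) @ \oo --> (0 : R)}.
  apply: (@ae_cvg0_inv_sqr _ _ _ _ _ 54) => //.
  - by move=> n; exact: bddmeas_deviation.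
  - by move=> n w; exact: deviation_ge0.
  - move=> n n1; apply: mean_deviation_le => //.
    + exact: ltW.
    + exact: t_prob.
    + exact: (sphere_dim_gt0 (X_unif n (Ordinal n1))).
have unit_ae : {ae P, forall w, forall n (i : 'I_n), dot (X n i w) (X n i w) = 1}.
  by apply: ae_foralln => n; exact: ae_sample_sphere.
apply: filterS2 Zcvg unit_ae => w Zw Xw.
pose G n := geometric_graph (t (d n)) (fun i : 'I_n => X n i w).
pose W n : R := \sum_j \sum_j'
  `|\sum_i centered p (@G n) i j * centered p (@G n) i j'|.
have W0 n : 0 <= W n by apply: sumr_ge0 => j _; exact: sumr_ge0.
have Wcvg : (fun n => W n / n%:R ^+ 3) @ \oo --> (0 : R).
  apply: (codegree_sum_cvg0 W0 Zw (dim_unbounded d_log)) => n m e n1 md e0 e1.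
  by apply: codegree_sum_le => //; [exact: ltW p1|exact: ltnW].
pose k := #|V|; pose q : R := \prod_(x <- vpairs V) pair_target H p x.
pose r n : R := (n ^ k)%:R / (n ^_ k)%:R.
pose delta n : R := Num.sqrt (W n / n%:R ^+ 3).
have dcvg : delta @ \oo --> (0 : R).
  rewrite -(sqrtr0 R); apply: continuous_cvg Wcvg; exact: sqrt_continuous.
pose bound n := (2 * (r n - 1) + (size (vpairs V))%:R * delta n * r n) / q.
have bcvg : bound @ \oo --> (0 : R).
  have rcvg : r @ \oo --> (1 : R) by exact: cvg_expn_ffact.
  have -> : 0 = (2 * (1 - 1) + (size (vpairs V))%:R * 0 * 1) / q :> R.
    by rewrite subrr !mulr0 mul0r addr0 mul0r.
  apply: cvgM; last exact: cvg_cst.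
  apply: cvgD; first by apply: cvgM; [exact: cvg_cst|apply: cvgB => //; exact: cvg_cst].
  by apply: cvgM => //; apply: cvgM => //; exact: cvg_cst.
apply: (@squeeze_cvgr _ _ _ _ (fun=> 0) bound) => //; last exact: cvg_cst.
near=> n; apply/andP; split=> //.
have n0 : (0 < n)%N by near: n; exact: nbhs_infty_gt.
apply: ratio_bound => //.
- exact: simple_geometric_graph.
- exact: sqrtr_ge0.
- by near: n; exact: nbhs_infty_ge.
- rewrite -/(W n) exprMn sqr_sqrtr ?divr_ge0 ?exprn_ge0 //.
  by apply: le_of_eq; field; rewrite pnatr_eq0 -lt0n.
Unshelve. all: by end_near.
Qed.
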